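(* Let $L\subset\mathbb{R}^4$ be the union of a two-dimensional lattice packing of translates of the closed unit ball in $\mathbb{R}^4$, where the corresponding two-dimensional point lattice is either the square lattice with edge length $2$ or the regular triangular lattice with edge length $2$ (lying in a two-dimensional plane). Then any packing of translates of $L$ in $\mathbb{R}^4$ (i.e. any packing of unit balls in $\mathbb{R}^4$ consisting of entire translates of $L$) has a density at most $\pi^2/16$, i.e. the density of a densest lattice packing of unit balls in $\mathbb{R}^4$.
   Context: A packing is a family of sets with pairwise disjoint interiors. The density of a packing is meant in the usual sense: the (upper) limit, as $\rho\to\infty$, of the proportion of the volume of the ball of radius $\rho$ about the origin covered by the members of the packing. *)

(* Defs.v *)
From mathcomp Require Import all_boot all_order all_algebra.
From mathcomp Require Import all_classical all_reals all_analysis.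

Set Implicit Arguments.
Unset Strict Implicit.
Unset Printing Implicit Defensive.

Import Order.TTheory GRing.Theory Num.Theory.
Import numFieldNormedType.Exports.

Local Open Scope classical_set_scope.
Local Open Scope ring_scope.

Definition dot (R : realType) (n : nat) (x y : 'rV[R]_n) : R :=
  \sum_(i < n) x 0 i * y 0 i.

(* The library norm `|x| on row vectors is the sup norm. *)
Definition enorm (R : realType) (n : nat) (x : 'rV[R]_n) : R :=
  Num.sqrt (dot x x).

Definition eball (R : realType) (n : nat) (c : 'rV[R]_n) (r : R) :
    set 'rV[R]_n :=
  [set x | enorm (x - c) <= r].

Definition vec4 (R : realType) (p : R * R * R * R) : 'rV[R]_4 :=
  let: (x0, x1, x2, x3) := p in
  \row_(i < 4) [:: x0; x1; x2; x3]`_i.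

(* Four-dimensional Lebesgue measure, as an iterated product transported along
   the coordinate bijection vec4. *)
Definition vol4 (R : realType) (A : set 'rV[R]_4) : \bar R :=
  (@lebesgue_measure R \x @lebesgue_measure R \x @lebesgue_measure R
     \x @lebesgue_measure R)%E (@vec4 R @^-1` A).

Definition translate (R : realType) (n : nat) (x : 'rV[R]_n)
    (A : set 'rV[R]_n) : set 'rV[R]_n :=
  [set x + y | y in A].

(* trivIset makes the interiors of any two distinct members of F disjoint. *)
Definition packing (R : realType) (n : nat) (F : set (set 'rV[R]_n)) : Prop :=
  trivIset F (@interior 'rV[R]_n).

Definition covered_proportion (R : realType) (F : set (set 'rV[R]_4))
    (rho : R) : \bar R :=
  (vol4 ((\bigcup_(A in F) A) `&` eball 0 rho) / vol4 (eball 0 rho))%E.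

Definition density (R : realType) (F : set (set 'rV[R]_4)) : \bar R :=
  limf_esup (covered_proportion F) +oo.

Definition lattice2 (R : realType) (n : nat) (a b : 'rV[R]_n) :
    set 'rV[R]_n :=
  [set v | exists i j : int, v = a *~ i + b *~ j].

Definition square_lattice (R : realType) (n : nat) (l : R)
    (Lam : set 'rV[R]_n) : Prop :=
  exists a b : 'rV[R]_n,
    [/\ enorm a = l, enorm b = l, dot a b = 0 & Lam = lattice2 a b].

Definition triangular_lattice (R : realType) (n : nat) (l : R)
    (Lam : set 'rV[R]_n) : Prop :=
  exists a b : 'rV[R]_n,
    [/\ enorm a = l, enorm b = l, enorm (a - b) = l & Lam = lattice2 a b].

Definition unit_ball_union (R : realType) (n : nat) (Lam : set 'rV[R]_n) :
    set 'rV[R]_n :=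
  \bigcup_(c in Lam) eball c 1.

(* Main.v *)
Require Import Defs.
From HB Require Import structures.
From mathcomp Require Import all_boot all_order all_algebra.
From mathcomp Require Import all_classical all_reals all_analysis.
From mathcomp Require Import measurable_realfun ring lra.

Import Order.TTheory GRing.Theory Num.Theory.
Import numFieldNormedType.Exports.

Local Open Scope classical_set_scope.
Local Open Scope ring_scope.

(** A rotation moves the lattice to [{(2 i + e j, h j, 0, 0)}], so that a ball
    centre of the packing splits as [(p + c, q)]: [p] and [q] are the
    coordinates of the translation vector along and across the lattice plane,
    and [c] runs over the planar lattice.  Two different translates satisfy
    [|p - p' - c|^2 + |q - q'|^2 >= 4] for every lattice vector [c]
    ([center_sep]).  Holes of the planar lattice have bounded depth, so choosing
    [c] well turns this into separation of the transverse points [q]: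
    - square lattice: [c] can be chosen with [|p - p' - c|^2 <= 2], hence
      [|q - q'|^2 >= 2].  For three translates the three differences of the
      points [p] cannot all sit at deep holes: three points on a circle of
      length 2 have squared distances with sum at most 2 ([circle_triple]),
      hence the three squared distances of the points [q] have sum at least 8;
    - triangular lattice: the squared covering radius is [4/3], hence
      [|q - q'|^2 >= 8/3].

    The planar heart of the proof is a lower bound for the Voronoi cell of [q],
    truncated to the disc of squared radius [r2] about [q]: its area is at least
    2 for [r2 = 1] in the square case and at least [4 / sqrt 3] for [r2 = 8/9]
    in the triangular case ([mu2_cell_square], [mu2_cell_triangular]).  Only
    finitely many bisectors cut the disc, and at most two of them meet at any
    point inside it.  Coning the two halves of each bisector segment from the
    centre gives disjoint wedges; a wedge with slope [t] over the bisector of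
    [0] and [a] contributes the triangle of area [|a|^2 t / 8] to the cell,
    while it spans the angle [atan t].  It is enough that the wedges carry on
    average at least [kappa] of area per radian, where [kappa] is the required
    area over [2 pi] ([mu2_cell]).  A wedge that ends on the circle satisfies
    this by itself ([cap_gain_le]).  A wedge that ends where two bisectors cross
    shares this vertex with exactly one other wedge, and the average of the two
    is estimated instead ([square_vertex_gain]); the two centres and [0] form a
    triangle of circumradius less than 1, and the claim comes down to the
    inequality [atan c >= pi (1/2 - 1/(2 + c + c^2))] on the unit interval
    ([atan_lower]), [c] being the cotangent of its angle at [0].  In the
    triangular case no two bisectors meet inside the disc, and only the first
    kind of wedge occurs.

    Multiplying the truncated cell by a fundamental brick of the lattice, of
    area 4 or [2 sqrt 3], attaches to every ball centre a tower of volume at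
    least 8, and the towers are disjoint ([tower_inj], [mu4_tower]).  Since
    towers have bounded diameter, the number of centres in a ball of radius
    [rho] is at most [vol (B (rho + 3)) / 8] ([count_le]); a unit ball has
    volume [pi^2 / 2] ([mu4_ball]), which gives the density bound
    [(pi^2 / 2) / 8 = pi^2 / 16]. *)

Set Implicit Arguments.
Unset Strict Implicit.
Unset Printing Implicit Defensive.

(** * Lebesgue measure of the plane and its invariances *)

Local Notation leb R := (@lebesgue_measure R).
Local Notation plane R := (measurableTypeR R * measurableTypeR R)%type.

Lemma measurable_set_lt d (T : measurableType d) (R : realType) (f g : T -> R) :
  measurable_fun setT f -> measurable_fun setT g ->
  measurable [set x | f x < g x].
Proof.
move=> mf mg.
have /(_ measurableT [set true]) := measurable_fun_ltr mf mg.
by rewrite setTI preimage_true; apply.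
Qed.

Lemma measurable_set_le d (T : measurableType d) (R : realType) (f g : T -> R) :
  measurable_fun setT f -> measurable_fun setT g ->
  measurable [set x | f x <= g x].
Proof.
move=> mf mg.
have /(_ measurableT [set true]) := measurable_fun_ler mf mg.
by rewrite setTI preimage_true; apply.
Qed.

Ltac mfun := repeat first
  [ exact: measurable_cst | exact: measurable_id | exact: measurable_fst
  | exact: measurable_snd
  | apply: measurable_fun_pair | apply: measurable_funD | apply: measurable_funB
  | apply: measurable_funM | apply: measurable_funX | apply: measurable_funN
  | exact: (measurableT_comp measurable_fst)
  | exact: (measurableT_comp measurable_snd)
  | apply: (measurableT_comp measurable_fst)
  | apply: (measurableT_comp measurable_snd)  ].

Lemma exists_pushforward d d' (T1 : measurableType d) (T2 : measurableType d') (R : realType)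
    (m : {measure set T1 -> \bar R}) (f : T1 -> T2) : measurable_fun setT f ->
  exists nu : {measure set T2 -> \bar R}, forall A, nu A = m (f @^-1` A).
Proof.
move=> mf; unshelve refine (ex_intro _ (pushforward m f : {measure set T2 -> \bar R}) _).
  exact: mf.
by [].
Qed.

Lemma measurable_preimage_setT d d' (T : measurableType d) (T' : measurableType d') (f :
  T -> T') A :
  measurable_fun setT f -> measurable A -> measurable (f @^-1` A).
Proof. by move=> mf mA; rewrite -[X in measurable X]setTI; exact: mf. Qed.

Lemma leb_shift (R : realType) (a : R) (A : set (measurableTypeR R)) : measurable A ->
  leb R ((fun x => a + x) @^-1` A) = leb R A.
Proof.
move=> mA.
have mf : measurable_fun (setT : set (measurableTypeR R)) ((fun x => a + x) :
  measurableTypeR R -> measurableTypeR R).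
  by mfun.
have [nu nuE] := exists_pushforward (leb R) mf.
rewrite [RHS](@lebesgue_measure_unique R nu) ?nuE //.
move=> X [[x y] /= xy <-]; rewrite nuE.
rewrite (_ : _ @^-1` _ = [set` `](x - a), (y - a)]]); last first.
  by apply/seteqP; split=> u /=; rewrite !in_itv /=; lra.
rewrite lebesgue_measure_itv /= [RHS]lebesgue_measure_itv /= !lte_fin ltrD2r.
by case: ifP => // _; rewrite -!EFinB; congr (_%:E); ring.
Qed.

Lemma leb_opp (R : realType) (A : set (measurableTypeR R)) : measurable A ->
  leb R (-%R @^-1` A) = leb R A.
Proof.
move=> mA.
have mf : measurable_fun (setT : set (measurableTypeR R)) ((fun x => - x) :
  measurableTypeR R -> measurableTypeR R).
  exact: oppr_measurable.
have [nu nuE] := exists_pushforward (leb R) mf.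
rewrite [RHS](@lebesgue_measure_unique R nu) ?nuE //.
move=> X [[x y] /= xy <-]; rewrite nuE.
rewrite (_ : _ @^-1` _ = [set` `[(- y), (- x)[]); last first.
  by apply/seteqP; split=> u /=; rewrite !in_itv /=; lra.
rewrite lebesgue_measure_itv /= [RHS]lebesgue_measure_itv /= !lte_fin ltrN2.
by case: ifP => // _; rewrite -!EFinB; congr (_%:E); ring.
Qed.

Lemma product_measure_ysection d1 d2 (T1 : measurableType d1)
    (T2 : measurableType d2) (R : realType)
    (m1 : {sigma_finite_measure set T1 -> \bar R})
    (m2 : {sigma_finite_measure set T2 -> \bar R}) (A : set (T1 * T2)) :
  measurable A ->
  ((m1 \x m2) A = \int[m2]_y m1 (ysection A y))%E.
Proof.
move=> mA.
have /(_ _ A mA) := @product_measure_unique _ _ _ _ _ m1 m2 (m1 \x^ m2)%E.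
by apply => B C mB mC; exact: product_measure2E.
Qed.

Lemma product_measure_map d1 d2 (T1 : measurableType d1)
    (T2 : measurableType d2) (R : realType)
    (m1 : {sigma_finite_measure set T1 -> \bar R})
    (m2 : {sigma_finite_measure set T2 -> \bar R})
    (f : T1 -> T1) (g : T2 -> T2) (A : set (T1 * T2)) :
  measurable_fun setT f -> measurable_fun setT g ->
  (forall B, measurable B -> m1 (f @^-1` B) = m1 B) ->
  (forall C, measurable C -> m2 (g @^-1` C) = m2 C) ->
  measurable A ->
  (m1 \x m2)%E ((fun z => (f z.1, g z.2)) @^-1` A) = (m1 \x m2)%E A.
Proof.
move=> mf mg m1f m2g mA.
have mfg : measurable_fun setT (fun z : T1 * T2 => (f z.1, g z.2)).
  by apply: measurable_fun_pair; exact: measurableT_comp.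
have [nu nuE] := exists_pushforward (m1 \x m2)%E mfg.
have /(_ _ A mA) := @product_measure_unique _ _ _ _ _ m1 m2 nu.
rewrite nuE => <- // B C mB mC; rewrite nuE.
rewrite (_ : _ @^-1` _ = (f @^-1` B) `*` (g @^-1` C)) //.
have mfB := measurable_preimage_setT mf mB; have mgC := measurable_preimage_setT mg mC.
apply: (etrans (product_measure1E m1 m2 mfB mgC)).
by congr (_ * _)%E; [exact: m1f|exact: m2g].
Qed.

Definition mu2 (R : realType) : set (plane R) -> \bar R := (leb R \x leb R)%E.

HB.instance Definition _ (R : realType) :=
  Measure.copy (@mu2 R) (leb R \x leb R)%E.

Lemma mu2_sigma_finite (R : realType) : sigma_finite setT (@mu2 R).
Proof.
exists (fun n => [set` `[- n%:R, n%:R]] `*` [set` `[- n%:R, n%:R]]).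
  apply/seteqP; split=> // -[x y] _; exists (Num.bound (`|x| + `|y|)) => //=.
  have b := archi_boundP (addr_ge0 (normr_ge0 x) (normr_ge0 y)).
  by rewrite !in_itv /= -!ler_norml; split; apply: le_trans (ltW b); rewrite ?lerDl ?lerDr.
move=> n; split; first by apply: measurableX; exact: measurable_itv.
have F : (leb R [set` `[(- n%:R)%R, (n%:R)%R]] < +oo)%E.
  by rewrite lebesgue_measure_itv /=; case: ifP => _; rewrite -?EFinB ltry.
rewrite [X in (X < _)%E](product_measure1E (leb R) (leb R)) //.
by apply: lte_mul_pinfty; rewrite ?ge0_fin_numE.
Qed.
HB.instance Definition _ (R : realType) :=
  Measure_isSigmaFinite.Build _ _ _ (@mu2 R) (@mu2_sigma_finite R).

Lemma mu2_def (R : realType) : @mu2 R = (leb R \x leb R)%E.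
Proof. by []. Qed.

Lemma mu2_xsection (R : realType) (A : set (plane R)) :
  @mu2 R A = (\int[leb R]_x (leb R (xsection A x)))%E.
Proof. by []. Qed.

Lemma mu2_ysection (R : realType) (A : set (plane R)) : measurable A ->
  @mu2 R A = (\int[leb R]_y (leb R (ysection A y)))%E.
Proof. exact: (product_measure_ysection (leb R) (leb R)). Qed.

Lemma mu2_setX (R : realType) (A B : set (measurableTypeR R)) :
  measurable A -> measurable B -> @mu2 R (A `*` B) = (leb R A * leb R B)%E.
Proof. exact: (product_measure1E (leb R) (leb R)). Qed.

Lemma mu2_map (R : realType) (f g : measurableTypeR R -> measurableTypeR R)
    (A : set (plane R)) :
  measurable_fun setT f -> measurable_fun setT g ->
  (forall B, measurable B -> leb R (f @^-1` B) = leb R B) ->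
  (forall C, measurable C -> leb R (g @^-1` C) = leb R C) ->
  measurable A -> @mu2 R ((fun z => (f z.1, g z.2)) @^-1` A) = @mu2 R A.
Proof. exact: (product_measure_map (m1 := leb R) (m2 := leb R)). Qed.

Global Opaque mu2.

Lemma mu2_shift (R : realType) (c : plane R) (A : set (plane R)) : measurable A ->
  @mu2 R ((fun z => (c.1 + z.1, c.2 + z.2)) @^-1` A) = @mu2 R A.
Proof. by apply: mu2_map; try exact: leb_shift; mfun. Qed.

Lemma mu2_opp (R : realType) (A : set (plane R)) : measurable A ->
  @mu2 R ((fun z => (- z.1, - z.2)) @^-1` A) = @mu2 R A.
Proof.
by apply: mu2_map; try exact: leb_opp; exact: oppr_measurable.
Qed.

Lemma mu2_csub (R : realType) (c : plane R) (A : set (plane R)) : measurable A ->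
  @mu2 R ((fun z => (c.1 - z.1, c.2 - z.2)) @^-1` A) = @mu2 R A.
Proof.
move=> mA; rewrite -[RHS](mu2_shift c) // -[RHS]mu2_opp //.
have mf : measurable_fun setT (fun z : plane R => (c.1 + z.1, c.2 + z.2) : plane R).
  by mfun.
exact: measurable_preimage_setT mf mA.
Qed.

Lemma mu2_refl (R : realType) (A : set (plane R)) : measurable A ->
  @mu2 R ((fun z => (z.1, - z.2)) @^-1` A) = @mu2 R A.
Proof.
move=> mA.
exact: (mu2_map (@measurable_id _ _ setT) (@oppr_measurable R setT)
  (fun _ _ => erefl) (@leb_opp R) mA).
Qed.

(** * Similarities of the plane *)

Lemma mu4_xsection (R : realType) (A : set (plane R * plane R)) : (@mu2 R \x @mu2 R)%E A =
  (\int[@mu2 R]_x (@mu2 R (xsection A x)))%E.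
Proof. by []. Qed.

Lemma integral_if_mem d (T : measurableType d) (R : realType) (m : {measure set T ->
  \bar R}) (A : set T) (c : \bar R) :
  measurable A -> (0 <= c)%E ->
  (\int[m]_x (if x \in A then c else 0) = c * m A)%E.
Proof.
move=> mA c0.
rewrite (eq_integral (fun x => c * (\1_A x)%:E)%E); last first.
  by move=> x _; rewrite indicE; case: ifP => /= _; rewrite ?mule1 ?mule0.
rewrite ge0_integralZl ?integral_indic ?setIT//; exact: measurableT_comp.
Qed.

(** Uniqueness of Haar measure, for the translation invariant measure A |->
    mu2 (g @^-1` A). The products on the two sides are the volumes of {(x, y)
    | g x in A, y + g x in B} and of {(x, y) | g x - y in A, g x in B},
    computed by slicing along x. Slicing along y instead, the sections at
    height y of these two sets are translates of each other by h y, because x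
    |-> h y + x corresponds under g to the translation by y. *)
Lemma mu2_haar (R : realType) (g h : plane R -> plane R) (A B : set (plane R)) :
  measurable_fun setT g ->
  (forall x y : plane R, g ((h y).1 + x.1, (h y).2 + x.2) = (y.1 + (g x).1, y.2 + (g x).2)) ->
  measurable A -> measurable B ->
  (@mu2 R (g @^-1` A) * @mu2 R B = @mu2 R (g @^-1` B) * @mu2 R A)%E.
Proof.
move=> mg gh mA mB.
have mgf : measurable_fun (setT : set (plane R * plane R)) (fun z => g z.1).
  exact: measurableT_comp.
pose E := [set z : plane R * plane R | A (g z.1) /\ B (z.2.1 + (g z.1).1, z.2.2 + (g z.1).2)].
pose E' := [set z : plane R * plane R | A ((g z.1).1 - z.2.1, (g z.1).2 - z.2.2) /\ B (g z.1)].
have m1 : measurable_fun (setT : set (plane R * plane R)) (fun z => (z.2.1 + (g z.1).1,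
  z.2.2 + (g z.1).2) : plane R).
  by mfun.
have m2 : measurable_fun (setT : set (plane R * plane R)) (fun z => ((g z.1).1 - z.2.1,
  (g z.1).2 - z.2.2) : plane R).
  by mfun.
have mE : measurable E.
  exact: measurableI (measurable_preimage_setT mgf mA) (measurable_preimage_setT m1 mB).
have mE' : measurable E'.
  exact: measurableI (measurable_preimage_setT m2 mA) (measurable_preimage_setT mgf mB).
have mgA := measurable_preimage_setT mg mA.
have mgB := measurable_preimage_setT mg mB.
have L : (@mu2 R \x @mu2 R)%E E = (@mu2 R B * @mu2 R (g @^-1` A))%E.
  rewrite mu4_xsection -integral_if_mem //; apply: eq_integral => x _.
  case: ifPn => [/set_mem xA|/negP xA].
    rewrite -[RHS](mu2_shift (g x)) //; congr (@mu2 R _).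
    apply/seteqP; split=> y; rewrite /xsection /= inE /E /=; rewrite [_ + y.1]addrC [_ + y.2]addrC.
      by case.
    by split.
  rewrite (_ : xsection _ _ = set0) ?measure0 //.
  by apply/seteqP; split=> y //; rewrite /xsection /= inE /E /= => -[p1 p2]; case: xA; rewrite inE.
have L' : (@mu2 R \x @mu2 R)%E E' = (@mu2 R A * @mu2 R (g @^-1` B))%E.
  rewrite mu4_xsection -integral_if_mem //; apply: eq_integral => x _.
  case: ifPn => [/set_mem xA|/negP xA].
    rewrite -[RHS](mu2_csub (g x)) //; congr (@mu2 R _).
    by apply/seteqP; split=> y; rewrite /xsection /= inE /E' /=; [case|split].
  rewrite (_ : xsection _ _ = set0) ?measure0 //.
  by apply/seteqP; split=> y //; rewrite /xsection /= inE /E' /= => -[p1 p2]; case: xA; rewrite inE.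
rewrite [LHS]muleC [RHS]muleC; apply: (etrans (esym L)); apply: (etrans _ L').
rewrite (product_measure_ysection _ _ mE) (product_measure_ysection _ _ mE').
apply: eq_integral => y _.
rewrite -[RHS](mu2_shift (h y)); last exact: measurable_ysection.
congr (@mu2 R _).
have cK (u v : R) : u + v - u = v by ring.
apply/seteqP; split=> x; rewrite /ysection /= !inE /E /E' /= gh /= !cK -surjective_pairing; by case.
Qed.

(** Complex multiplication by q; every orientation preserving similarity of
    the plane that fixes 0 has this form. *)
Definition cmul (R : realType) (q z : plane R) : plane R :=
  (q.1 * z.1 - q.2 * z.2, q.1 * z.2 + q.2 * z.1).
Definition sqnorm (R : realType) (z : plane R) : R := z.1 ^+ 2 + z.2 ^+ 2.
Definition disc (R : realType) (r2 : R) : set (plane R) := [set z | sqnorm z < r2].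

Definition dot2 (R : realType) (z w : plane R) : R := z.1 * w.1 + z.2 * w.2.
Definition cross (R : realType) (z w : plane R) : R := z.1 * w.2 - z.2 * w.1.

Lemma dot2C (R : realType) (a b : plane R) : dot2 a b = dot2 b a.
Proof. by rewrite /dot2 mulrC [_.2 * _]mulrC. Qed.
Lemma crossC (R : realType) (a b : plane R) : cross a b = - cross b a.
Proof. by rewrite /cross; ring. Qed.
Lemma cross_id (R : realType) (a : plane R) : cross a a = 0.
Proof. by rewrite /cross; ring. Qed.
Lemma dot2_id (R : realType) (a : plane R) : dot2 a a = sqnorm a.
Proof. by rewrite /dot2 /sqnorm !expr2. Qed.
Lemma cross_sqr (R : realType) (a b : plane R) : cross a b ^+ 2 =
  sqnorm a * sqnorm b - dot2 a b ^+ 2.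
Proof. by rewrite /cross /sqnorm /dot2; ring. Qed.

Definition sqdist (R : realType) (a b : plane R) : R := sqnorm ((a.1 - b.1, a.2 - b.2) : plane R).

Lemma sqdistE (R : realType) (a b : plane R) : sqdist a b = sqnorm a + sqnorm b - 2 * dot2 a b.
Proof. by rewrite /sqdist /sqnorm /dot2 /=; ring. Qed.

Lemma measurable_cmul (R : realType) (q : plane R) : measurable_fun setT (cmul q).
Proof. by rewrite /cmul; mfun. Qed.

Lemma measurable_sqnorm (R : realType) : measurable_fun setT (@sqnorm R).
Proof. by rewrite /sqnorm; mfun. Qed.

Lemma measurable_disc (R : realType) (r2 : R) : measurable (disc r2).
Proof. by apply: measurable_set_lt; [exact: measurable_sqnorm|mfun]. Qed.

Lemma sqnorm_ge0 (R : realType) (z : plane R) : 0 <= sqnorm z.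
Proof. by rewrite /sqnorm addr_ge0 // sqr_ge0. Qed.

Lemma mu2_haar_cmul (R : realType) (q : plane R) (A B : set (plane R)) : 0 < sqnorm q ->
  measurable A -> measurable B ->
  (@mu2 R (cmul q @^-1` A) * @mu2 R B = @mu2 R (cmul q @^-1` B) * @mu2 R A)%E.
Proof.
move=> q0 mA mB.
apply: (@mu2_haar _ _ (fun y => (((q.1 * y.1 + q.2 * y.2) / sqnorm q,
  (q.1 * y.2 - q.2 * y.1) / sqnorm q) : plane R))) => //.
  exact: measurable_cmul.
move=> x y; rewrite /cmul /=; move: q0; rewrite /sqnorm => q0.
by congr (_, _); field; rewrite gt_eqF.
Qed.

Definition box (R : realType) (a b : R) : set (plane R) := [set` `]a, b[] `*` [set` `]a, b[].

Lemma leb_itv_oo (R : realType) (a b : R) : a <= b ->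
  leb R [set` `]a, b[] = (b - a)%:E.
Proof.
move=> ab; rewrite lebesgue_measure_itv /= lte_fin; case: ltP => ba; rewrite -?EFinB //.
by have -> : b = a; [apply/eqP; rewrite eq_le ba ab | rewrite subrr].
Qed.

Lemma mu2_box (R : realType) (a b : R) : a <= b -> @mu2 R (box a b) = ((b - a) ^+ 2)%:E.
Proof.
move=> ab; apply: (etrans (mu2_setX (measurable_itv `]a, b[) (measurable_itv `]a, b[))).
by rewrite expr2 EFinM; congr (_ * _)%E; exact: leb_itv_oo.
Qed.

Lemma measurable_box (R : realType) (a b : R) : measurable (box a b).
Proof. by apply: measurableX. Qed.

Lemma ge0_lty_fin (R : realType) (x : \bar R) : (0 <= x)%E -> (x < +oo)%E -> x \is a fin_num.
Proof. by move=> x0 xoo; rewrite ge0_fin_numE. Qed.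

Lemma mu2_disc_fin (R : realType) (r2 : R) : (@mu2 R (disc r2) < +oo)%E.
Proof.
have sub : disc r2 `<=` box (- (r2 + 1)) (r2 + 1).
  move=> [x y]; rewrite /disc /box /sqnorm /= !in_itv /= => h.
  by split; apply/andP; split; nra.
apply: (le_lt_trans (le_measure _ _ _ sub)); rewrite ?inE.
- exact: measurable_disc.
- exact: measurable_box.
have [r0|r0] := leP 0 (r2 + 1).
  by rewrite /= mu2_box ?ltry //; lra.
rewrite (_ : box _ _ = set0) ?measure0 //; apply/seteqP; split=> // -[x y] [] /=.
by rewrite !in_itv /= => /andP[]; lra.
Qed.

Lemma mu2_disc_gt0 (R : realType) : (0 < @mu2 R (disc 1))%E.
Proof.
have sub : box (- (2^-1 : R)) 2^-1 `<=` disc 1.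
  move=> [x y]; rewrite /disc /box /sqnorm /= !in_itv /= => -[] /andP[? ?] /andP[? ?]; nra.
apply: (@lt_le_trans _ _ (@mu2 R (box (- (2^-1 : R)) 2^-1))).
  by rewrite mu2_box ?lte_fin; lra.
apply: le_measure sub; rewrite ?inE; [exact: measurable_box | exact: measurable_disc].
Qed.

(** By uniqueness of Haar measure a rotation multiplies area by a constant;
    the constant is 1 because the unit disc is invariant and has finite
    positive area. *)
Lemma mu2_rotation (R : realType) (q : plane R) (A : set (plane R)) : sqnorm q = 1 ->
  measurable A ->
  @mu2 R (cmul q @^-1` A) = @mu2 R A.
Proof.
move=> q1 mA.
have H : (@mu2 R (cmul q @^-1` A) * @mu2 R (disc 1) = @mu2 R A * @mu2 R (disc 1))%E.
  have q0 : 0 < sqnorm q by rewrite q1.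
  apply: (etrans (mu2_haar_cmul q0 mA (measurable_disc 1))).
  rewrite [LHS]muleC; congr (_ * @mu2 R _)%E.
  have E z : sqnorm (cmul q z) = sqnorm z.
    by rewrite -[RHS]mul1r -q1 /sqnorm /cmul /=; ring.
  by apply/seteqP; split=> z; rewrite /disc /= E.
have f1 : @mu2 R (disc 1) \is a fin_num.
  exact: ge0_lty_fin (measure_ge0 _ _) (mu2_disc_fin 1).
have f0 := mu2_disc_gt0 R.
by apply/eqP; rewrite eq_le; apply/andP; split; rewrite -(lee_pmul2r f1 f0) H.
Qed.

(** The same argument, with the constant read off from a square. *)
Lemma mu2_scaling (R : realType) (s : R) (A : set (plane R)) : 0 < s -> measurable A ->
  @mu2 R A = ((s ^+ 2)%:E * @mu2 R (cmul (s, 0%R) @^-1` A))%E.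
Proof.
move=> s0 mA.
have H := mu2_haar_cmul (q := (s, 0)) _ mA (measurable_box (0:R) 1).
rewrite mu2_box // subr0 expr1n mule1 in H.
rewrite H; last by rewrite /sqnorm /= expr0n addr0 exprn_gt0.
rewrite (_ : _ @^-1` _ = box 0 s^-1); last first.
  apply/seteqP; split=> -[x y]; rewrite /box /cmul /= !in_itv /= !mul0r subr0 addr0;
  by rewrite !pmulr_rgt0 // -!ltr_pdivlMl // mulr1.
rewrite mu2_box ?invr_ge0 ?(ltW s0) // subr0 muleA -EFinM -exprMn mulfV ?gt_eqF //.
by rewrite expr1n mul1e.
Qed.

Lemma mu2_cmul (R : realType) (q : plane R) (A : set (plane R)) : 0 < sqnorm q -> measurable A ->
  @mu2 R A = ((sqnorm q)%:E * @mu2 R (cmul q @^-1` A))%E.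
Proof.
move=> q0 mA; set s := Num.sqrt (sqnorm q).
have s0 : 0 < s by rewrite sqrtr_gt0.
have s2 : s ^+ 2 = sqnorm q by rewrite sqr_sqrtr // ltW.
have n1 : sqnorm ((q.1 / s, q.2 / s) : plane R) = 1.
  rewrite /sqnorm /= !expr_div_n -mulrDl s2 mulfV // gt_eqF //.
rewrite -[LHS](mu2_rotation n1) // (mu2_scaling s0); last by apply: measurable_preimage_setT
  => //; exact: measurable_cmul.
rewrite s2; congr (_ * @mu2 R _)%E.
have E' (z : plane R) : cmul (q.1 / s, q.2 / s) (cmul (s, 0) z) = cmul q z.
  by rewrite /cmul /=; congr (_, _); field; rewrite gt_eqF.
by apply/seteqP; split=> z; rewrite /= E'.
Qed.

(** * Areas of discs, cones and lines *)

Lemma integral_derive (R : realType) (F f : R -> R) (a b : R) : a <= b ->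
  (forall x : R, is_derive x (1 : R) F (f x)) -> continuous f ->
  (\int[leb R]_(x in `[a, b]) (f x)%:E = (F b - F a)%:E)%E.
Proof.
rewrite le_eqVlt => /predU1P[<-|ab] dF cf.
  by rewrite set_itv1 integral_set1 subrr.
have cF : continuous F.
  by move=> x; apply: differentiable_continuous; apply/derivable1_diffP; apply: ex_derive.
rewrite (continuous_FTC2 ab (F := F)) //.
- exact: continuous_subspaceT.
- split; first by move=> x _; exact: ex_derive.
  + exact: cvg_at_right_filter (cF a).
  + exact: cvg_at_left_filter (cF b).
- by move=> x _; rewrite derive1E derive_val.
Qed.

Lemma integral_sin_subst (R : realType) (G : R -> R) (a b : R) :
  - (pi / 2) <= a -> a <= b -> b <= pi / 2 -> continuous G ->
  (\int[leb R]_(x in `[sin a, sin b]) (G x)%:E =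
   \int[leb R]_(x in `[a, b]) (G (sin x) * cos x)%:E)%E.
Proof.
move=> ha ab hb cG.
have D : derive1 (@sin R) = @cos R.
  by apply/funext => x; rewrite derive1E derive_val.
rewrite integration_by_substitution_increasing ?D //.
- move=> x y /[!in_itv] /= /andP[ax xb] /andP[ay yb] xy.
  by rewrite ltr_sin // in_itv /=; apply/andP; split; lra.
- by move=> x _; exact: continuous_cos.
- by apply/cvg_ex; exists (cos a); apply: cvg_at_right_filter; exact: continuous_cos.
- by apply/cvg_ex; exists (cos b); apply: cvg_at_left_filter; exact: continuous_cos.
- split; first by move=> x _; exact: ex_derive.
  + exact: cvg_at_right_filter (@continuous_sin R a).
  + exact: cvg_at_left_filter (@continuous_sin R b).
- exact: continuous_subspaceT.
Qed.

(** With x = sin theta the integrand becomes cos^2 theta - k sin theta cos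
    theta, which has an elementary primitive. For k = 0 the integral computes
    discs; a nonzero k is the side of a circular sector. *)
Lemma integral_arc (R : realType) (k a b : R) :
  - (pi / 2) <= a -> a <= b -> b <= pi / 2 ->
  (\int[leb R]_(x in `[sin a, sin b]) (Num.sqrt (1 - x ^+ 2) - k * x)%:E =
   ((b + sin b * cos b - k * (sin b) ^+ 2) / 2 - (a + sin a * cos a - k * (sin a) ^+ 2) / 2)%:E)%E.
Proof.
move=> ha ab hb.
rewrite integral_sin_subst //; last first.
  move=> x; apply: cvgB; last by apply: cvgM; [exact: cvg_cst|exact: cvg_id].
  apply: (@continuous_comp _ _ _ (fun x : R => 1 - x ^+ 2) Num.sqrt); last exact: sqrt_continuous.
  by apply: cvgB; [exact: cvg_cst| exact: exprn_continuous].
transitivity (\int[leb R]_(x in `[a, b]) (cos x ^+ 2 - k * (sin x * cos x))%:E)%E.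
  apply: eq_integral => x /[!inE] /= /[!in_itv] /= /andP[h1 h2]; congr (_%:E).
  rewrite -cos2sin2 sqrtr_sqr ger0_norm; first by ring.
  by apply: cos_ge0_pihalf; apply/andP; split; lra.
have dF (x : R) : is_derive x (1 : R) (fun x :
  R => (x + sin x * cos x - k * (sin x) ^+ 2) / 2) (cos x ^+ 2 - k * (sin x * cos x)).
  apply: is_derive_eq.
  rewrite /GRing.scale /=.
  have := cos2Dsin2 x; lra.
have cf : continuous (fun x : R => cos x ^+ 2 - k * (sin x * cos x)).
  move=> x; apply: cvgB.
    exact: (continuous_comp (@continuous_cos R x) (@exprn_continuous R 2 _)).
  by apply: cvgM; [exact: cvg_cst| apply: cvgM; [exact: continuous_sin|exact: continuous_cos]].
rewrite (integral_derive ab dF cf).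
by congr (_%:E); ring.
Qed.

Lemma mu2_integral_x (R : realType) (A : set (plane R)) (a b : R) (g : R -> R) : continuous g ->
  (forall x, a < x < b -> leb R (xsection A x) = (g x)%:E) ->
  (forall z, A z -> a < z.1 < b) ->
  @mu2 R A = (\int[leb R]_(x in `[a, b]) (g x)%:E)%E.
Proof.
move=> cg h1 h2.
rewrite [RHS]integral_itv_bndoo; last first.
  by apply/measurable_EFinP; apply: measurable_funTS; exact: continuous_measurable_fun.
rewrite mu2_xsection [RHS]integral_mkcond; apply: eq_integral => x _.
rewrite patchE; case: ifPn => [/set_mem /= |/negP].
  by rewrite in_itv /= => /h1.
rewrite inE /= in_itv /= => xab.
rewrite (_ : xsection _ _ = set0) ?measure0 //.
by apply/seteqP; split=> y //; rewrite /xsection /= inE => /h2.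
Qed.

Lemma mu2_integral_y (R : realType) (A : set (plane R)) (a b : R) (g : R ->
  R) : measurable A -> continuous g ->
  (forall x, a < x < b -> leb R (ysection A x) = (g x)%:E) ->
  (forall z, A z -> a < z.2 < b) ->
  @mu2 R A = (\int[leb R]_(x in `[a, b]) (g x)%:E)%E.
Proof.
move=> mA cg h1 h2.
rewrite [RHS]integral_itv_bndoo; last first.
  by apply/measurable_EFinP; apply: measurable_funTS; exact: continuous_measurable_fun.
rewrite mu2_ysection // [RHS]integral_mkcond; apply: eq_integral => x _.
rewrite patchE; case: ifPn => [/set_mem /= |/negP].
  by rewrite in_itv /= => /h1.
rewrite inE /= in_itv /= => xab.
rewrite (_ : ysection _ _ = set0) ?measure0 //.
by apply/seteqP; split=> y //; rewrite /ysection /= inE => /h2.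
Qed.

Lemma ltr_sqrt_sqr (R : realType) (x y : R) : 0 <= x -> (x < Num.sqrt y) = (x ^+ 2 < y).
Proof.
move=> x0; have [y0|y0] := leP 0 y.
  by rewrite -[in RHS](sqr_sqrtr y0) ltr_pXn2r // nnegrE sqrtr_ge0.
by rewrite ler0_sqrtr ?(ltW y0) // ltNge x0; symmetry; apply/negbTE;
  rewrite -leNgt (le_trans (ltW y0)) // sqr_ge0.
Qed.

Lemma continuous_arc (R : realType) (k : R) : continuous (fun x : R => Num.sqrt (1 - x ^+ 2)
  - k * x).
Proof.
move=> x; apply: cvgB; last by apply: cvgM; [exact: cvg_cst|exact: cvg_id].
apply: (@continuous_comp _ _ _ (fun x : R => 1 - x ^+ 2) Num.sqrt); last exact: sqrt_continuous.
by apply: cvgB; [exact: cvg_cst| exact: exprn_continuous].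
Qed.

Lemma mu2_disc1 (R : realType) : @mu2 R (disc 1) = pi%:E.
Proof.
have cg : continuous (fun x : R => 2 * (Num.sqrt (1 - x ^+ 2) - 0 * x)).
  by move=> x; apply: cvgM; [exact: cvg_cst|exact: continuous_arc].
rewrite (mu2_integral_x (a := -1) (b := 1) cg); first last.
- by move=> [x y]; rewrite /disc /sqnorm /= => h; apply/andP; split; nra.
- move=> x x1; rewrite (_ : xsection _ _ = [set` `](- Num.sqrt (1 - x ^+ 2)),
  (Num.sqrt (1 - x ^+ 2))[]).
    rewrite leb_itv_oo; first by congr (_%:E); ring.
    by rewrite -subr_ge0 opprK addr_ge0 ?sqrtr_ge0.
  apply/seteqP; split=> y; rewrite /xsection /= inE /disc /sqnorm /= in_itv /= -ltr_norml.
    by rewrite ltr_sqrt_sqr // real_normK ?num_real //; lra.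
  by rewrite ltr_sqrt_sqr // real_normK ?num_real //; lra.
have h := @integral_arc R 0 (- (pi / 2)) (pi / 2).
rewrite sinN sin_pihalf cosN cos_pihalf in h.
have pi0 := pi_gt0 R.
under eq_integral do rewrite EFinM.
rewrite ge0_integralZl //; last 2 first.
- apply/measurable_EFinP; apply: measurable_funTS;
  exact: continuous_measurable_fun (@continuous_arc R 0).
- by move=> x _; rewrite lee_fin mul0r subr0 sqrtr_ge0.
rewrite h; [|lra..].
by rewrite -EFinM; congr (_%:E); field.
Qed.

Lemma mu2_disc (R : realType) (r2 : R) : 0 < r2 -> @mu2 R (disc r2) = (r2 * pi)%:E.
Proof.
move=> r0; rewrite (mu2_scaling (s := Num.sqrt r2)) ?sqrtr_gt0 //; last exact: measurable_disc.
rewrite sqr_sqrtr ?(ltW r0) // EFinM -mu2_disc1; congr (_ * @mu2 R _)%E.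
have E (z : plane R) : sqnorm (cmul (Num.sqrt r2, 0) z) = r2 * sqnorm z.
  by rewrite /sqnorm /cmul /= !mul0r subr0 addr0 !exprMn sqr_sqrtr ?(ltW r0) // -mulrDr.
by apply/seteqP; split=> z; rewrite /disc /= E gtr_pMr.
Qed.

Definition cone (R : realType) (t : R) : set (plane R) := [set z | 0 < z.2 < t * z.1].

Lemma measurable_cone (R : realType) (t : R) : measurable (cone t).
Proof.
rewrite (_ : cone t = [set z | 0 < z.2] `&` [set z | z.2 < t * z.1]); last first.
  by apply/seteqP; split=> z; rewrite /cone /=; [move/andP|move=> [-> ->]].
by apply: measurableI; apply: measurable_set_lt; mfun.
Qed.

(** The triangle with vertices 0, (1, 0) and (1, t). *)
Lemma mu2_cone_triangle (R : realType) (t : R) : 0 < t ->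
  @mu2 R (cone t `&` [set z | z.1 < 1]) = (t / 2)%:E.
Proof.
move=> t0; have cf : continuous (fun x : R => t * x).
  by move=> x; apply: cvgM; [exact: cvg_cst|exact: cvg_id].
rewrite (mu2_integral_x (a := 0) (b := 1) cf); first last.
- move=> [x y] /= [] /andP[] /= h1 h2 h3; rewrite h3 andbT.
  by rewrite -(pmulr_rgt0 _ t0) (lt_trans h1).
- move=> x /andP[x0 x1].
  rewrite (_ : xsection _ _ = [set` `]0, (t * x)[]).
    by rewrite leb_itv_oo ?subr0 // mulr_ge0 // ltW.
  by apply/seteqP; split=> y; rewrite /xsection /= inE /cone /= in_itv /=; [case|split].
have dF (x : R) : is_derive x (1 : R) (fun x : R => t * x ^+ 2 / 2) (t * x).
  by apply: is_derive_eq; rewrite /GRing.scale /=; field.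
by rewrite (integral_derive _ dF cf) //; congr (_%:E); field.
Qed.

(** A sector of angle atan t, sliced horizontally: at height y it extends from
    the side x = y / t to the circle. *)
Lemma mu2_cone_disc1 (R : realType) (t : R) : 0 < t ->
  @mu2 R (cone t `&` disc 1) = (atan t / 2)%:E.
Proof.
move=> t0; set A := atan t.
have A0 : 0 < A by rewrite -(@atan0 R) lt_atan.
have A1 : A < pi / 2 by exact: atan_ltpi2.
have c0 : 0 < cos A by apply: cos_gt0_pihalf; apply/andP; split; lra.
have tE : t * cos A = sin A by rewrite -[t in LHS]atanK /tan -/A mulfVK ?gt_eqF.
have s0 : 0 < sin A by rewrite -tE mulr_gt0.
have cs := cos2Dsin2 A.
rewrite (mu2_integral_y (a := 0) (b := sin A) _ (@continuous_arc R t^-1)); first last.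
- move=> [x y] /= [] /andP[] /= h1 h2; rewrite /disc /sqnorm /= => h3; rewrite h1 /=.
  have x0 : 0 < x by rewrite -(pmulr_rgt0 _ t0) (lt_trans h1).
  rewrite -(ltr_pXn2r (n := 2)) ?nnegrE ?(ltW h1) ?(ltW s0) //.
  have : y ^+ 2 < t ^+ 2 * x ^+ 2 by rewrite -exprMn ltr_pXn2r ?nnegrE ?(ltW h1) // ltW //
    (lt_trans h1).
  have : t ^+ 2 * cos A ^+ 2 = sin A ^+ 2 by rewrite -exprMn tE.
  nra.
- move=> y /andP[y0 y1].
  have h : y / t <= Num.sqrt (1 - y ^+ 2).
    rewrite ltW // ltr_sqrt_sqr ?divr_ge0 ?(ltW y0) ?(ltW t0) //.
    have : y / t < cos A by rewrite ltr_pdivrMr // mulrC tE.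
    have : 0 < y / t by rewrite divr_gt0.
    nra.
  rewrite (_ : ysection _ _ = [set` `](y / t), (Num.sqrt (1 - y ^+ 2))[]).
    by rewrite leb_itv_oo //; congr (_%:E); rewrite mulrC.
  apply/seteqP; split=> x; rewrite /ysection /= inE /cone /disc /sqnorm /= in_itv /=.
    move=> [] /andP[_ h1] h2; rewrite ltr_pdivrMr // mulrC h1 /= ltr_sqrt_sqr; first by lra.
    by nra.
  move=> /andP[h1 h2]; have x0 : 0 < x by rewrite (lt_trans _ h1) // divr_gt0.
  rewrite ltr_sqrt_sqr ?(ltW x0) // in h2.
  by rewrite y0 mulrC -ltr_pdivrMr //; split=> //; lra.
- apply: measurableI; [exact: measurable_cone|exact: measurable_disc].
have := @integral_arc R t^-1 0 A; rewrite sin0 => ->; [|lra..].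
congr (_%:E); rewrite -tE; field; lra.
Qed.

Lemma mu2_cone_disc (R : realType) (t r2 : R) : 0 < t -> 0 < r2 ->
  @mu2 R (cone t `&` disc r2) = (r2 * (atan t / 2))%:E.
Proof.
move=> t0 r0; rewrite (mu2_scaling (s := Num.sqrt r2)) ?sqrtr_gt0 //; last first.
  by apply: measurableI; [exact: measurable_cone|exact: measurable_disc].
rewrite sqr_sqrtr ?(ltW r0) // EFinM -mu2_cone_disc1 //; congr (_ * @mu2 R _)%E.
have E (z : plane R) : sqnorm (cmul (Num.sqrt r2, 0) z) = r2 * sqnorm z.
  by rewrite /sqnorm /cmul /= !mul0r subr0 addr0 !exprMn sqr_sqrtr ?(ltW r0) // -mulrDr.
have E' (z : plane R) : cone t (cmul (Num.sqrt r2, 0) z) = cone t z.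
  rewrite /cone /cmul /= !mul0r subr0 addr0 mulrCA pmulr_rgt0 ?sqrtr_gt0 //.
  by rewrite ltr_pM2l ?sqrtr_gt0.
have E'' (z : plane R) : disc r2 (cmul (Num.sqrt r2, 0) z) = disc 1 z.
  by rewrite /disc /= E gtr_pMr.
by rewrite preimage_setI; congr (_ `&` _); apply/funext => z; rewrite /preimage /=.
Qed.

Definition line (R : realType) (q : plane R) : set (plane R) := [set z | cross q z = 0].

Lemma measurable_line (R : realType) (q : plane R) : measurable (line q).
Proof.
rewrite (_ : line q = [set z | cross q z <= 0] `&` [set z | 0 <= cross q z]).
  by apply: measurableI; apply: measurable_set_le; rewrite /cross; mfun.
by apply/seteqP; split=> z; rewrite /line /=; [lra|case; lra].
Qed.

(** A similarity moves the line to the horizontal axis, where every vertical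
    section is a point. *)
Lemma mu2_line (R : realType) (q : plane R) : 0 < sqnorm q -> @mu2 R (line q) = 0%:E.
Proof.
move=> q0; rewrite (mu2_cmul q0); last exact: measurable_line.
rewrite (_ : _ @^-1` _ = setT `*` [set 0]); last first.
  apply/seteqP; split=> -[x y]; rewrite /line /cross /cmul /=.
    move=> h; split=> //; have : sqnorm q * y = 0 by rewrite -h /sqnorm; ring.
    by move/eqP; rewrite mulf_eq0 (gt_eqF q0) /= => /eqP.
  by move=> [_ ->]; ring.
by rewrite mu2_setX // lebesgue_measure_set1 mule0 mule0.
Qed.

(** * Finite covers and packings, and frames adapted to a bisector *)

Lemma measure_le_cover d (T : measurableType d) (R : realType) (m : {measure set T -> \bar R})
  (I : eqType) (s : seq I) (A : I -> set T) (B : set T) :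
  (forall i, measurable (A i)) -> measurable B ->
  (forall z, B z -> exists2 i, i \in s & A i z) ->
  (m B <= \sum_(i <- s) m (A i))%E.
Proof.
move=> mA; elim: s B => [|i s IH] B mB BA.
  rewrite big_nil (_ : B = set0) ?measure0 //.
  by apply/seteqP; split=> z // /BA [].
rewrite big_cons.
have mBD : measurable (B `\` A i) by exact: measurableD.
have sub : B `<=` A i `|` (B `\` A i).
  by move=> z Bz; have [|nA] := pselect (A i z); [left|right].
apply: (le_trans (le_measure _ _ _ sub)); rewrite ?inE //; first exact: measurableU.
apply: (le_trans (measureU2 _ _ _)) => //.
apply: leeD => //; apply: IH => // z [/BA [j]] /[!inE] /predU1P[-> //|js] Aj _.
by exists j.
Qed.

Lemma measure_ge_disjoint d (T : measurableType d) (R : realType) (m : {measure set T -> \bar R})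
  (I : eqType) (s : seq I) (A : I -> set T) (B : set T) :
  uniq s -> (forall i, measurable (A i)) -> measurable B ->
  (forall i z, i \in s -> A i z -> B z) ->
  (forall i j z, i \in s -> j \in s -> A i z -> A j z -> i = j) ->
  (\sum_(i <- s) m (A i) <= m B)%E.
Proof.
move=> + mA; elim: s B => [|i s IH] B /= us mB AB dA; first by rewrite big_nil.
move: us => /andP[nis us].
have mBD : measurable (B `\` A i) by exact: measurableD.
have AiB : A i `<=` B by move=> z; apply: AB; rewrite inE eqxx.
rewrite big_cons -(setDUK AiB) measureU //; last by rewrite setDIK.
apply: leeD => //; apply: IH => //.
- move=> j z js Aj; split; first by apply: AB Aj; rewrite inE js orbT.
  move=> Ai; move: nis; rewrite (dA i j z) ?js //; rewrite inE ?eqxx ?js ?orbT //.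
- by move=> j k z js ks; apply: dA; rewrite inE ?js ?ks orbT.
Qed.

Definition orient (R : realType) (s : bool) : R := if s then 1 else -1.
(** Similarity coordinates adapted to q: the first one is 0 at the origin and
    1 on the bisector of 0 and q, and the second one vanishes on the ray
    through q; its sign is chosen by s, so that the two sides of that ray can
    be treated as one. *)
Definition frame (R : realType) (q : plane R) (s : bool) (z : plane R) : plane R :=
  (2 * dot2 z q / sqnorm q, orient R s * (2 * cross q z) / sqnorm q).

Lemma measurable_frame (R : realType) (q : plane R) s : measurable_fun setT (frame q s).
Proof. by rewrite /frame /dot2 /cross; mfun. Qed.

Lemma orientN (R : realType) s : orient R (~~ s) = - orient R s.
Proof. by case: s; rewrite /orient /= ?opprK. Qed.
Lemma orient_sqr (R : realType) s : orient R s * orient R s = 1.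
Proof. by case: s; rewrite /orient ?mulrNN mul1r. Qed.

Lemma mu2_frame (R : realType) (q : plane R) s (A : set (plane R)) : 0 < sqnorm q -> measurable A ->
  @mu2 R (frame q s @^-1` A) = ((sqnorm q / 4)%:E * @mu2 R A)%E.
Proof.
move=> q0 mA.
pose h : plane R := (q.1 / 2, q.2 / 2).
have hE : sqnorm h = sqnorm q / 4 by rewrite /h /sqnorm /=; field.
have h0 : 0 < sqnorm h by rewrite hE; lra.
rewrite (mu2_cmul h0); last by apply: measurable_preimage_setT => //; exact: measurable_frame.
rewrite hE; congr (_ * _)%E.
have E z : frame q s (cmul h z) = (z.1, orient R s * z.2).
  by move: q0; rewrite /frame /cmul /h /dot2 /cross /sqnorm /= => q0; congr (_, _); field;
    rewrite gt_eqF.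
case: s E => E.
  by congr (@mu2 R _); apply/seteqP; split=> z; rewrite /= E /= mul1r -surjective_pairing.
rewrite -[RHS]mu2_refl //.
by congr (@mu2 R _); apply/seteqP; split=> z; rewrite /= E /= mulN1r.
Qed.

(** In the frame of a, the height of the point where the bisectors of 0, a and
    of 0, b cross, that is of the circumcentre of 0, a, b. It is also the
    cotangent of the angle of this triangle at b. *)
Definition vertex_slope (R : realType) (a b : plane R) : R := (sqnorm b - dot2 a b) / `|cross a b|.

Lemma vertex_slopeE (R : realType) (a b : plane R) s : 0 < orient R s * cross a b ->
  vertex_slope a b = (sqnorm b - dot2 a b) / (orient R s * cross a b).
Proof.
by rewrite /vertex_slope; case: s; rewrite /orient ?mul1r ?mulN1r => h;
  [rewrite gtr0_norm|rewrite ltr0_norm // -oppr_gt0].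
Qed.

Lemma dot2_frame (R : realType) (a b z : plane R) s : 0 < sqnorm a ->
  2 * dot2 z b = (frame a s z).1 * dot2 a b + (frame a s z).2 * (orient R s * cross a b).
Proof.
rewrite /frame /dot2 /cross /sqnorm /=; move=> a0.
by case: s; rewrite /orient; field; rewrite gt_eqF.
Qed.

Lemma sqnorm_frame (R : realType) (a z : plane R) s : 0 < sqnorm a ->
  sqnorm z = sqnorm a / 4 * ((frame a s z).1 ^+ 2 + (frame a s z).2 ^+ 2).
Proof.
rewrite /frame /dot2 /cross /sqnorm /=; move=> a0.
by case: s; rewrite /orient; field; rewrite gt_eqF.
Qed.

Lemma frame_ex (R : realType) (a : plane R) s (xi eta : R) : 0 < sqnorm a ->
  exists z, frame a s z = (xi, eta).
Proof.
move=> a0; exists (cmul (a.1 / 2, a.2 / 2) (xi, orient R s * eta)).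
move: a0; rewrite /frame /cmul /dot2 /cross /sqnorm /= => a0.
by case: s; rewrite /orient; congr (_, _); field; rewrite gt_eqF.
Qed.

Lemma cross_neq (R : realType) (a b : plane R) s : 0 < orient R s * cross a b -> a != b :> plane R.
Proof.
by apply: contraTN => /eqP ->; rewrite cross_id mulr0 ltxx.
Qed.

(** * Lower bound for the area of a truncated Voronoi cell *)

Section Cell.
Variables (R : realType) (n : nat) (q : 'I_n -> plane R) (r2 kappa : R).

(** In the frame of a, the height at which the bisector of 0 and a leaves the
    disc of squared radius r2. *)
Definition cap_slope (a : plane R) : R := Num.sqrt (4 * r2 / sqnorm a - 1).
(** The circumcentre of 0, a, b lies inside the disc of squared radius r2. *)
Definition vertex_inside (a b : plane R) : bool := sqnorm a * (1 + vertex_slope a b ^+ 2) < 4 * r2.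

(** A pair x = (j, s) stands for one half of the bisector of 0 and q j, cut at
    its midpoint. Its partner is the index of the bisector that crosses this
    half inside the disc. *)
Definition partner (x : 'I_n * bool) (k : 'I_n) : bool :=
  (0 < orient R x.2 * cross (q x.1) (q k)) && vertex_inside (q x.1) (q k).

(** Where the half bisector stops, in its frame: at the crossing with the
    partner, or at the circle. *)
Definition aperture (x : 'I_n * bool) : R :=
  if [pick k | partner x k] is Some k then vertex_slope (q x.1) (q k) else cap_slope (q x.1).

(** The two half bisectors that end in a common vertex lie on opposite sides
    of the rays to their points, whence the negation. *)
Definition partner_flip (x : 'I_n * bool) : 'I_n * bool :=
  if [pick k | partner x k] is Some k then (k, ~~ x.2) else x.

(** The union of the open rays from 0 through the half bisector. *)
Definition wedge (x : 'I_n * bool) : set (plane R) := frame (q x.1) x.2 @^-1` cone (aperture x).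

Definition cell : set (plane R) := [set z | sqnorm z < r2 /\ forall j, 2 * dot2 z (q j) <
  sqnorm (q j)].

Hypothesis facet_near : forall j, 0 < sqnorm (q j) < 4 * r2.
Hypothesis facet_acute : forall j k, j != k -> dot2 (q j) (q k) < sqnorm (q k).
(** Two bisectors that cross inside the disc cross strictly on the side of 0
    of every third one, so that vertices have degree two and no crossing is
    cut off. *)
Hypothesis facet_sparse : forall j k l, j != k -> j != l -> k != l ->
  forall v : plane R, sqnorm v < r2 ->
  2 * dot2 v (q j) = sqnorm (q j) -> 2 * dot2 v (q k) = sqnorm (q k) ->
    2 * dot2 v (q l) < sqnorm (q l).
(** At least kappa of area per radian, for a wedge that ends on the
    circle. *)
Hypothesis cap_gain : forall j, kappa * atan (cap_slope (q j)) <=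
  sqnorm (q j) * cap_slope (q j) / 8.
(** The same average for the two wedges that share a vertex, taken
    together. *)
Hypothesis vertex_gain : forall j k, j != k -> cross (q j) (q k) != 0 ->
  vertex_inside (q j) (q k) ->
  kappa * (atan (vertex_slope (q j) (q k)) + atan (vertex_slope (q k) (q j))) <=
  (sqnorm (q j) * vertex_slope (q j) (q k) + sqnorm (q k) * vertex_slope (q k) (q j)) / 8.
Hypothesis kappa_range : 0 <= kappa <= r2 / 2.

Lemma partner_neq x k : partner x k -> x.1 != k.
Proof.
move=> /andP[h _]; have := cross_neq h; apply: contraNneq => ->; exact.
Qed.

Lemma vertex_slope_gt0 x k : 0 < orient R x.2 * cross (q x.1) (q k) ->
  0 < vertex_slope (q x.1) (q k).
Proof.
move=> h; rewrite (vertex_slopeE h) divr_gt0 // subr_gt0 facet_acute //.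
by have := cross_neq h; apply: contraNneq => ->.
Qed.

(** If two bisectors crossed the half bisector inside the disc, the crossing
    further out would lie beyond the bisector crossed first, against
    facet_sparse. *)
Lemma partner_uniq_le x k l : partner x k -> partner x l ->
  vertex_slope (q x.1) (q k) <= vertex_slope (q x.1) (q l) -> k = l.
Proof.
move=> pk pl le; apply/eqP/negPn/negP => kl.
have /andP[x0 _] := facet_near x.1.
have [v vE] := frame_ex x.2 1 (vertex_slope (q x.1) (q l)) x0.
have jk := partner_neq pk; have jl := partner_neq pl.
move: pk pl => /andP[ck mk] /andP[cl ml].
have Dj := dot2_frame (q x.1) v x.2 x0.
have Dk := dot2_frame (q k) v x.2 x0.
have Dl := dot2_frame (q l) v x.2 x0.
have Nv := sqnorm_frame v x.2 x0.
rewrite !vE /= in Dj Dk Dl Nv.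
have Nlt : sqnorm v < r2.
  by move: ml; rewrite /vertex_inside Nv; lra.
have Dj' : 2 * dot2 v (q x.1) = sqnorm (q x.1).
  by rewrite Dj cross_id !mulr0 addr0 mul1r dot2_id.
have Dl' : 2 * dot2 v (q l) = sqnorm (q l).
  by rewrite Dl (vertex_slopeE cl) mulfVK ?gt_eqF //; ring.
have lk : l != k by rewrite eq_sym.
have := facet_sparse jl jk lk Nlt Dj' Dl'.
rewrite Dk => hv.
have : vertex_slope (q x.1) (q k) * (orient R x.2 * cross (q x.1) (q k)) <=
  vertex_slope (q x.1) (q l) * (orient R x.2 * cross (q x.1) (q k)).
  by rewrite ler_pM2r.
by rewrite {1}(vertex_slopeE ck) mulfVK ?gt_eqF //; lra.
Qed.

Lemma partner_uniq x k l : partner x k -> partner x l -> k = l.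
Proof.
move=> pk pl; have [|/ltW] := leP (vertex_slope (q x.1) (q k)) (vertex_slope (q x.1) (q l)).
  exact: partner_uniq_le.
by move=> h; symmetry; exact: (partner_uniq_le pl pk).
Qed.

Lemma cap_slope_gt0 j : 0 < cap_slope (q j).
Proof.
have /andP[x0 x4] := facet_near j.
by rewrite sqrtr_gt0 subr_gt0 ltr_pdivlMr ?mul1r.
Qed.

Lemma cap_slope_sqr j : sqnorm (q j) * (1 + cap_slope (q j) ^+ 2) = 4 * r2.
Proof.
have /andP[x0 x4] := facet_near j.
rewrite sqr_sqrtr; first by field; rewrite gt_eqF.
by rewrite subr_ge0 ler_pdivlMr ?mul1r // ltW.
Qed.

(** Both the crossing and the exit point lie on the bisector, so the crossing
    is inside the disc when it is lower than the exit. *)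
Lemma vertex_insideE j k : 0 <= vertex_slope (q j) (q k) -> vertex_inside (q j) (q k) =
  (vertex_slope (q j) (q k) < cap_slope (q j)).
Proof.
move=> s0; have /andP[x0 x4] := facet_near j.
rewrite /vertex_inside -(cap_slope_sqr j) ltr_pM2l // ltrD2l ltr_pXn2r // nnegrE //.
exact: ltW (cap_slope_gt0 j).
Qed.

Lemma aperture_gt0 x : 0 < aperture x.
Proof.
rewrite /aperture; case: pickP => [k /andP[h _]|_]; [exact: vertex_slope_gt0|exact: cap_slope_gt0].
Qed.

Lemma aperture_le_cap x : aperture x <= cap_slope (q x.1).
Proof.
rewrite /aperture; case: pickP => [k /andP[h]|_] //.
by rewrite vertex_insideE ?(ltW (vertex_slope_gt0 h)) // => /ltW.
Qed.

Lemma aperture_le_vertex x l : 0 < orient R x.2 * cross (q x.1) (q l) ->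
  aperture x <= vertex_slope (q x.1) (q l).
Proof.
move=> h; rewrite leNgt; apply/negP => lt.
have pl : partner x l.
  rewrite /partner h vertex_insideE ?(ltW (vertex_slope_gt0 h)) //.
  exact: lt_le_trans lt (aperture_le_cap x).
move: lt; rewrite /aperture; case: pickP => [k pk|/(_ l)]; last by rewrite pl.
by rewrite (partner_uniq pk pl) ltxx.
Qed.

(** Along a ray in the wedge of j the bisector of j is reached before any
    other one: the ratio 2 <z, q l> / |q l|^2 is the inverse of the time at
    which the ray reaches the bisector of l. Bisectors on the other side of
    the ray to q j are harmless because no triangle 0, q j, q l has an obtuse
    angle at q l. *)
Lemma wedge_dominates x z l : wedge x z -> l != x.1 ->
  2 * dot2 z (q l) < (frame (q x.1) x.2 z).1 * sqnorm (q l).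
Proof.
move=> /andP[]; set eta := (frame _ _ _).2; set xi := (frame _ _ _).1 => e0 exi lx.
have /andP[x0 x4] := facet_near x.1.
have xi0 : 0 < xi by rewrite -(pmulr_rgt0 _ (aperture_gt0 x)) (lt_trans e0).
rewrite (dot2_frame (q l) z x.2 x0) -/xi -/eta -ltrBrDl -mulrBr.
have [c0|c0] := ltP 0 (orient R x.2 * cross (q x.1) (q l)).
  rewrite -ltr_pdivlMr // -mulrA -vertex_slopeE // mulrC (lt_le_trans exi) //.
  by rewrite ler_pM2r // aperture_le_vertex.
apply: (@le_lt_trans _ _ 0); first by rewrite mulr_ge0_le0 // ltW.
by rewrite mulr_gt0 // subr_gt0 facet_acute // eq_sym.
Qed.

Lemma frame_fst j s z : (frame (q j) s z).1 * sqnorm (q j) = 2 * dot2 z (q j).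
Proof. by have /andP[x0 _] := facet_near j; rewrite /frame /= mulfVK // gt_eqF. Qed.

Lemma wedge_disjoint x y z : wedge x z -> wedge y z -> x = y.
Proof.
move=> Cx Cy.
have xy1 : x.1 = y.1.
  apply/eqP/negPn/negP => ne.
  have ne' : y.1 != x.1 by rewrite eq_sym.
  have := wedge_dominates Cx ne'; have := wedge_dominates Cy ne.
  have /andP[x0 _] := facet_near x.1; have /andP[y0 _] := facet_near y.1.
  rewrite -(frame_fst x.1 x.2) -(frame_fst y.1 y.2) !ltr_pM2r // => h h'.
  by have := lt_trans h h'; rewrite ltxx.
case: x y xy1 Cx Cy => [j s] [k s'] /= <- /andP[+ _] /andP[+ _].
have /andP[x0 _] := facet_near j.
rewrite /frame /= pmulr_lgt0 ?invr_gt0 // => a; rewrite pmulr_lgt0 ?invr_gt0 // => b; move: a b.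
by case: s; case: s' => //; rewrite /orient /= ?mul1r ?mulN1r; move=> h h'; exfalso; lra.
Qed.

Lemma wedge_cell x z : wedge x z -> (frame (q x.1) x.2 z).1 < 1 -> cell z.
Proof.
move=> Cz; move: (Cz) => /andP[]; set eta := (frame _ _ _).2; set xi :=
  (frame _ _ _).1 => e0 exi xi1.
have /andP[x0 x4] := facet_near x.1.
have xi0 : 0 < xi by rewrite -(pmulr_rgt0 _ (aperture_gt0 x)) (lt_trans e0).
split.
  rewrite (sqnorm_frame z x.2 x0) -/xi -/eta.
  have : sqnorm (q x.1) * (xi ^+ 2 + eta ^+ 2) < sqnorm (q x.1) * (1 + cap_slope (q x.1) ^+ 2).
    rewrite ltr_pM2l //.
    have : eta < cap_slope (q x.1).
      apply: (lt_le_trans exi); apply: le_trans (aperture_le_cap x).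
      by rewrite ger_pMr ?aperture_gt0 // ltW.
    have := cap_slope_gt0 x.1; nra.
  by rewrite cap_slope_sqr; lra.
move=> l; have [->|lx] := eqVneq l x.1.
  by rewrite -(frame_fst _ x.2) -/xi gtr_pMl.
apply: (lt_trans (wedge_dominates Cz lx)); rewrite -/xi gtr_pMl //.
by have /andP[] := facet_near l.
Qed.

(** A point of the disc beyond some bisector belongs to the bisector that the
    ray from 0 reaches first. Ties between two bisectors and points on the
    axes through the q j are left out; they form finitely many lines. *)
Lemma wedge_cover z : sqnorm z < r2 -> ~ cell z ->
  (forall j k, j != k -> dot2 z (q j) * sqnorm (q k) - dot2 z (q k) * sqnorm (q j) <> 0) ->
  (forall j, cross (q j) z <> 0) -> exists x, wedge x z.
Proof.
move=> zr nc ntie nax.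
have [k zk] : exists k, sqnorm (q k) <= 2 * dot2 z (q k).
  apply: contrapT => h; apply: nc; split => // j; rewrite ltNge; apply/negP => hj.
  by apply: h; exists j.
(* f j >= 1 when z is beyond the bisector of j; the largest f j is reached first *)
pose f j := 2 * dot2 z (q j) / sqnorm (q j).
have [j _ /(_ _ isT) jmax] := arg_maxP f (erefl true : predT k).
pose s := 0 < cross (q j) z.
have /andP[x0 x4] := facet_near j.
exists (j, s).
have fj : 1 <= f j.
  have /andP[k0 _] := facet_near k.
  by apply: le_trans (jmax k); rewrite ler_pdivlMr ?mul1r.
have e0 : 0 < (frame (q j) s z).2.
  rewrite /frame /= divr_gt0 //.
  have nj := nax j; rewrite /s /orient; have [h|h] := ltP 0 (cross (q j) z); first by lra.
  have : cross (q j) z < 0 by rewrite lt_neqAle h andbT; apply/eqP.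
  lra.
have fE : (frame (q j) s z).1 = f j by [].
change (is_true (0 < (frame (q j) s z).2 < aperture (j, s) * f j)); rewrite e0 andTb.
rewrite /aperture [(j, s).1]/=; case: pickP => [l pl|_].
  have jl := partner_neq pl; move: pl => /andP[c _].
  rewrite [(j, s).1]/= [(j, s).2]/= in jl c.
  rewrite (vertex_slopeE c) mulrAC ltr_pdivlMr //.
  have /andP[l0 _] := facet_near l.
  have : f l < f j.
    rewrite lt_neqAle (jmax l : f l <= f j) andbT; apply/eqP; rewrite /f => E.
    apply: (ntie _ _ jl); apply/eqP; rewrite subr_eq0; apply/eqP.
    move: E => /(congr1 (fun u => u * (sqnorm (q l) * sqnorm (q j)) / 2)).
    by rewrite (_ : _ / 2 = dot2 z (q l) * sqnorm (q j)); [move=> ->|]; field; rewrite ?gt_eqF.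
  rewrite {1}/f ltr_pdivrMr // (dot2_frame (q l) z s x0) fE mulrBl.
  by rewrite ltrBrDr addrC [sqnorm _ * _]mulrC [dot2 _ _ * _]mulrC.
have fj0 : 0 <= f j by rewrite (le_trans _ fj).
rewrite -(ltr_pXn2r (n := 2)) ?nnegrE ?(ltW e0) ?(mulr_ge0 (ltW (cap_slope_gt0 j)) fj0) //.
have : sqnorm (q j) * ((frame (q j) s z).1 ^+ 2 + (frame (q j) s z).2 ^+ 2) <
  sqnorm (q j) * (1 + cap_slope (q j) ^+ 2).
  by rewrite cap_slope_sqr; move: zr; rewrite (sqnorm_frame z s x0); lra.
rewrite ltr_pM2l // fE.
have f2 : 1 <= f j ^+ 2 by rewrite exprn_ege1.
have s2 := sqr_ge0 (cap_slope (q j)).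
have : 0 <= (f j ^+ 2 - 1) * (1 + cap_slope (q j) ^+ 2) by rewrite mulr_ge0 ?subr_ge0 // addr_ge0.
move: (f j) (cap_slope (q j)) ((frame (q j) s z).2) => u v w a b. lra.
Qed.

(** The circumcentre of 0, q j, q k is symmetric in j and k, as is its
    distance from 0, while the orientation of the pair changes sign. *)
Lemma partnerC j s k : partner (j, s) k -> partner (k, ~~ s) j.
Proof.
move=> /andP[c m]; rewrite [(j, s).1]/= [(j, s).2]/= in c m.
have /andP[x0 _] := facet_near j; have /andP[y0 _] := facet_near k.
have cc : orient R (~~ s) * cross (q k) (q j) = orient R s * cross (q j) (q k).
  by rewrite orientN (crossC (q k)); ring.
have c' : 0 < orient R (~~ s) * cross (q k) (q j) by rewrite cc.
rewrite /partner [(k, _).1]/= [(k, _).2]/= c' andTb.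
move: m; rewrite /vertex_inside (vertex_slopeE c) (vertex_slopeE c') cc [dot2 (q k) _]dot2C.
have := cross_sqr (q j) (q k).
have : (orient R s * cross (q j) (q k)) ^+ 2 = cross (q j) (q k) ^+ 2.
  by rewrite exprMn expr2 orient_sqr mul1r.
move: c; set c := orient R s * _ => c0; rewrite !expr_div_n.
set x := sqnorm (q j); set y := sqnorm (q k); set p := dot2 _ _ => -> cE.
suff -> : y * (1 + (x - p) ^+ 2 / cross (q j) (q k) ^+ 2) =
  x * (1 + (y - p) ^+ 2 / cross (q j) (q k) ^+ 2) by [].
have cn : cross (q j) (q k) != 0 by apply: contraTneq c0 => c0; rewrite /c c0 mulr0 ltxx.
move: (expf_neq0 2 cn) cE; move: (cross _ _ ^+ 2) => D D0 DE.
have -> : y * (1 + (x - p) ^+ 2 / D) = (y * (D + (x - p) ^+ 2)) / D by field.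
have -> : x * (1 + (y - p) ^+ 2 / D) = (x * (D + (y - p) ^+ 2)) / D by field.
by congr (_ / _); rewrite DE; ring.
Qed.

Lemma pick_partner x k : partner x k -> [pick k | partner x k] = Some k.
Proof.
move=> pk; case: pickP => [l pl|/(_ k)]; last by rewrite pk.
by rewrite (partner_uniq pk pl).
Qed.

(** This is what lets vertices be counted once from each of their two
    wedges. *)
Lemma partner_flipK : involutive partner_flip.
Proof.
move=> [j s]; rewrite /partner_flip; case E: [pick k | partner (j, s) k] => [k|]; last by rewrite E.
have pk : partner (j, s) k by move: E; case: pickP => // l pl [<-].
by rewrite (pick_partner (partnerC pk)) negbK.
Qed.

(** Area of the triangle in the wedge, in excess of kappa times its angle. *)
Definition gain x : R := sqnorm (q x.1) * aperture x / 8 - kappa * atan (aperture x).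

Lemma gain_flip x : 0 <= gain x + gain (partner_flip x).
Proof.
case: x => j s; rewrite /partner_flip; case E: [pick k | partner (j, s) k] => [k|].
  have pk : partner (j, s) k by move: E; case: pickP => // l pl [<-].
  rewrite /gain /aperture E (pick_partner (partnerC pk)) /=.
  have jk := partner_neq pk; move: (pk) => /andP[/= c m].
  have c0 : cross (q j) (q k) != 0 by apply: contraTneq c => ->; rewrite mulr0 ltxx.
  by have := vertex_gain jk c0 m; lra.
by rewrite /gain /aperture E /=; have := cap_gain j; lra.
Qed.

(** Twice the sum is the sum over x of the pair gain at x and at its flip. *)
Lemma gain_sum : 0 <= \sum_x gain x.
Proof.
have E : \sum_x gain x = \sum_x gain (partner_flip x)
  by exact: (reindex_inj (inv_inj partner_flipK)).
have : 0 <= \sum_x (gain x + gain (partner_flip x)) by apply: sumr_ge0 => x _; exact: gain_flip.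
by rewrite big_split /= -E; lra.
Qed.

Lemma measurable_cell : measurable cell.
Proof.
have -> : cell = disc r2 `&` \bigcap_(j in setT) [set z | 2 * dot2 z (q j) < sqnorm (q j)].
  apply/seteqP; split=> z; first by case=> a b; split=> // j _; exact: b.
  by case=> a b; split=> // j; exact: b.
apply: measurableI; first exact: measurable_disc.
apply: fin_bigcap_measurable => [|j _]; first exact: finite_finset.
by apply: measurable_set_lt; rewrite /dot2; mfun.
Qed.

Lemma measurable_wedge x : measurable (wedge x).
Proof. exact: measurable_preimage_setT (measurable_frame _ _) (measurable_cone _). Qed.

Lemma mu2_wedge_triangle x : @mu2 R (wedge x `&` [set z | (frame (q x.1) x.2 z).1 < 1]) =
  (sqnorm (q x.1) * aperture x / 8)%:E.
Proof.
have /andP[x0 _] := facet_near x.1.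
rewrite (_ : _ `&` _ = frame (q x.1) x.2 @^-1` (cone (aperture x) `&` [set z | z.1 < 1])) //.
rewrite mu2_frame // ?mu2_cone_triangle ?aperture_gt0 //; last first.
  by apply: measurableI; [exact: measurable_cone|apply: measurable_set_lt; mfun].
by rewrite -EFinM; congr (_%:E); field.
Qed.

Lemma mu2_wedge_disc x : 0 < r2 -> @mu2 R (wedge x `&` disc r2) = (r2 * (atan (aperture x) / 2))%:E.
Proof.
move=> r0; have /andP[x0 _] := facet_near x.1.
rewrite (_ : _ `&` _ = frame (q x.1) x.2 @^-1` (cone (aperture x) `&` disc (4
  * r2 / sqnorm (q x.1)))); last first.
  rewrite preimage_setI; congr (_ `&` _); apply/funext => z; apply/propext.
  rewrite /disc /= {1}(sqnorm_frame z x.2 x0) ltr_pdivlMr // /sqnorm.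
  by split; lra.
rewrite mu2_frame // ?mu2_cone_disc ?aperture_gt0 //; first by rewrite -EFinM; congr (_%:E);
  field; rewrite gt_eqF.
- by rewrite divr_gt0 // mulr_gt0.
- by apply: measurableI; [exact: measurable_cone|exact: measurable_disc].
Qed.

(** The part D of the cell outside all wedges is also the part of the disc
    outside all wedges, up to null lines. So the cell has area at least |D| +
    S and the disc has area r2 pi at most |D| + (r2 / 2) A, where S is the
    area of the triangles and A the sum of the angles. Now S >= kappa A, and
    kappa <= r2 / 2 says that D too carries at least kappa per radian. *)
Lemma mu2_cell : 0 < r2 -> ((2 * pi * kappa)%:E <= @mu2 R cell)%E.
Proof.
move=> r0.
pose I := ('I_n * bool)%type.
pose D := cell `\` \bigcup_(x in setT) wedge x.
have mU : measurable (\bigcup_(x in setT) wedge x).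
  by apply: fin_bigcup_measurable => [|x _]; [exact: finite_finset|exact: measurable_wedge].
have mD : measurable D by exact: measurableD measurable_cell mU.
have Dfin : @mu2 R D \is a fin_num.
  apply: ge0_lty_fin; first exact: measure_ge0.
  apply: (le_lt_trans _ (mu2_disc_fin r2)); apply: le_measure; rewrite ?inE //.
    exact: measurable_disc.
  by move=> z [[]].
pose a := fine (@mu2 R D).
have Da : @mu2 R D = a%:E by rewrite /a fineK.
have a0 : 0 <= a by rewrite /a fine_ge0 // measure_ge0.
pose low_part (o : option I) :=
  if o is Some x then wedge x `&` [set z | (frame (q x.1) x.2 z).1 < 1] else D.
have low : ((a + \sum_(x : I) sqnorm (q x.1) * aperture x / 8)%:E <= @mu2 R cell)%E.
  have mlow o : measurable (low_part o).
    case: o => [x|] //=; apply: measurableI; first exact: measurable_wedge.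
    apply: measurable_set_lt; last by mfun.
    by rewrite /frame /dot2 /=; mfun.
  have := @measure_ge_disjoint _ _ R (@mu2 R) _ (None :: [seq Some x | x <- index_enum I])
    low_part cell _ mlow measurable_cell.
  rewrite big_cons big_map /= Da EFinD -sumEFin.
  under eq_bigr do rewrite mu2_wedge_triangle.
  apply.
  - rewrite map_inj_uniq ?index_enum_uniq ?andbT; last by move=> x y [].
    by apply/negP => /mapP[].
  - by move=> [x|] z _ /=; [case=> cx; exact: wedge_cell | case].
  - move=> [x|] [y|] z _ _ //=.
    + by move=> [cx _] [cy _]; rewrite (wedge_disjoint cx cy).
    + by move=> [cx _] [_]; case; exists x.
    + by move=> [_ h] [cx _]; case: h; exists y.
pose J := (option I + ('I_n * 'I_n + 'I_n))%type.
(* the line of ties between the bisectors of j and k is orthogonal to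
   |q k|^2 q j - |q j|^2 q k *)
pose nrm (j k : 'I_n) : plane R := ((q j).2 * sqnorm (q k) - (q k).2 * sqnorm (q j),
  - ((q j).1 * sqnorm (q k) - (q k).1 * sqnorm (q j))).
have nrm0 j k : j != k -> 0 < sqnorm (nrm j k).
  move=> jk; have /andP[x0 _] := facet_near j; have /andP[y0 _] := facet_near k.
  have := facet_acute jk; have := facet_acute (_ : k != j); rewrite eq_sym => /(_ jk);
    rewrite [dot2 (q k) _]dot2C => a1 a2.
  have -> : sqnorm (nrm j k) = sqnorm (q j) * sqnorm (q k) * (sqnorm (q j) + sqnorm (q k)
    - 2 * dot2 (q j) (q k)).
    by rewrite /sqnorm /nrm /dot2 /sqnorm /=; ring.
  by rewrite !mulr_gt0 //; lra.
pose up_part (o : J) := match o with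
  | inl (Some x) => wedge x `&` disc r2
  | inl None => D
  | inr (inl (j, k)) => if j == k then set0 else line (nrm j k)
  | inr (inr j) => line (q j) end.
have up : r2 * pi <= a + \sum_(x : I) r2 * (atan (aperture x) / 2).
  have mup o : measurable (up_part o).
    case: o => [[x|]|[[j k]|j]] //=; [|case: ifP => // _;
      exact: measurable_line|exact: measurable_line].
    by apply: measurableI; [exact: measurable_wedge|exact: measurable_disc].
  have := @measure_le_cover _ _ R (@mu2 R) _ ((inl None :: [seq inl (Some x) | x <-
    index_enum I]) ++ [seq inr x | x <- index_enum ('I_n * 'I_n + 'I_n)%type]) up_part (disc
      r2) mup (measurable_disc _).
  rewrite big_cat big_cons !big_map /= Da.
  rewrite [X in (_ + X)%E]big1 ?adde0; last first.
    move=> [[j k]|j] _ /=; last by apply: mu2_line; have /andP[] := facet_near j.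
    by case: eqP => [_|/eqP jk]; [rewrite measure0|apply: mu2_line; exact: nrm0].
  under eq_bigr do rewrite (mu2_wedge_disc _ r0).
  rewrite sumEFin -EFinD mu2_disc // lee_fin; apply => z zr.
  have [[x Cx]|nC] := pselect (exists x, wedge x z).
    exists (inl (Some x)); last by split.
    by rewrite inE mem_cat (map_f (fun x => inl (Some x))) ?mem_index_enum ?orbT.
  have [Kz|nK] := pselect (cell z).
    exists (inl None); first by rewrite inE eqxx.
    by split => // -[x _ Cx]; apply: nC; exists x.
  have inr_mem (x : 'I_n * 'I_n + 'I_n) :
    inr x \in (inl None :: [seq inl (Some x) | x <- index_enum I]) ++ [seq inr x | x <-
      index_enum ('I_n * 'I_n + 'I_n)%type].
    by rewrite inE mem_cat (map_f inr) ?mem_index_enum ?orbT.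
  have [[j Lj]|nL] := pselect (exists j, line (q j) z).
    exists (inr (inr j)); [exact: inr_mem|exact: Lj].
  have [[[j k] [jk Ljk]]|nL'] := pselect (exists jk : 'I_n * 'I_n, jk.1 != jk.2 /\
    line (nrm jk.1 jk.2) z).
    exists (inr (inl (j, k))); first exact: inr_mem.
    by rewrite /= (negbTE jk).
  exfalso; apply: nC; apply: wedge_cover => //.
    move=> j k jk E; apply: nL'; exists (j, k); split => //.
    by rewrite /line /cross /nrm /= -E /dot2; ring.
  by move=> j E; apply: nL; exists j; exact: E.
apply: le_trans low; rewrite lee_fin.
have := gain_sum; rewrite /gain big_split /= sumrN -mulr_sumr subr_ge0.
have upE : \sum_(x : I) r2 * (atan (aperture x) / 2) = r2 / 2 * \sum_(x : I) atan (aperture x).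
  by rewrite mulr_sumr; apply: eq_bigr => x _; ring.
rewrite upE in up.
set S1 := \sum_i atan _; set S2 := \sum_i _ => h.
have /andP[k0 k1] := kappa_range.
rewrite -/S1 in up; rewrite -(ler_pM2l r0).
have u1 : kappa * (r2 * pi) <= kappa * (a + r2 / 2 * S1) by rewrite ler_wpM2l.
have u2 : r2 * (kappa * S1) <= r2 * S2 by rewrite ler_wpM2l // ltW.
have u3 : a * kappa <= a * (r2 / 2) by rewrite ler_wpM2l.
lra.
Qed.

End Cell.

(** * Inequalities between the arctangent and rational functions *)

Lemma mean_value (R : realType) (g g' : R -> R) (a b : R) : a <= b ->
  (forall x : R, is_derive x (1 : R) g (g' x)) ->
  exists2 c, a <= c <= b & g b - g a = g' c * (b - a).
Proof.
move=> ab dg.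
have cg : continuous g.
  by move=> x; apply: differentiable_continuous; apply/derivable1_diffP; apply: ex_derive.
have [c] := @MVT_segment R g g' a b ab (fun x _ => dg x) (continuous_subspaceT cg).
by rewrite in_itv /= => cab E; exists c.
Qed.

(** The sign of the derivative changes at most once, from positive to
    negative, so the minimum is at an end of the interval. *)
Lemma unimodal_ge0 (R : realType) (g s p : R -> R) (a b : R) :
  (forall x : R, is_derive x (1 : R) g (s x * p x)) ->
  (forall x, 0 < p x) ->
  (forall x y, a <= x -> x <= y -> y <= b -> s y <= s x) ->
  0 <= g a -> 0 <= g b -> forall x, a <= x <= b -> 0 <= g x.
Proof.
move=> dg p0 sn ga gb x /andP[ax xb].
have [sx|sx] := leP 0 (s x).
  have [c /andP[ac cx] E] := mean_value ax dg.
  have : 0 <= s c * p c * (x - a).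
    by rewrite mulr_ge0 ?subr_ge0 // mulr_ge0 ?(ltW (p0 c)) // (le_trans sx) // sn.
  by rewrite -E; lra.
have [c /andP[xc cb] E] := mean_value xb dg.
have : s c * p c * (b - x) <= 0.
  rewrite mulr_le0_ge0 ?subr_ge0 // mulr_le0_ge0 ?(ltW (p0 c)) //.
  by apply: le_trans (ltW sx); exact: sn.
by rewrite -E; lra.
Qed.

Lemma cos_pi6 (R : realType) : cos (pi / 6 : R) ^+ 2 = 3 / 4.
Proof.
have pi0 := pi_gt0 R.
set a := pi / 6.
have c0 : 0 < cos a by apply: cos_gt0_pihalf; rewrite /a; apply/andP; split; lra.
have := @cos_pihalf R.
have -> : pi / 2 = a + (a + a) by rewrite /a; field.
have := cos2Dsin2 a.
rewrite cosD (cosD a a) (sinD a a); set c := cos a; set s := sin a => cs.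
have -> : c * (c * c - s * s) - s * (s * c + c * s) = c * (4 * c ^+ 2 - 3).
  have -> : s * (s * c + c * s) = 2 * c * s ^+ 2 by ring.
  have -> : s * s = s ^+ 2 by ring.
  have -> : s ^+ 2 = 1 - c ^+ 2 by lra.
  ring.
move/eqP; rewrite mulf_eq0 gt_eqF //= => /eqP; lra.
Qed.

Lemma atan_sqrt3 (R : realType) : atan ((Num.sqrt 3)^-1 : R) = pi / 6.
Proof.
have pi0 := pi_gt0 R.
have c2 := cos_pi6 R.
have := cos2Dsin2 (pi / 6 : R); rewrite c2 => s2.
have c0 : 0 < cos (pi / 6 : R) by apply: cos_gt0_pihalf; apply/andP; split; lra.
have s0 : 0 < sin (pi / 6 : R) by apply: sin_gt0_pihalf; apply/andP; split; lra.
have r3 : (Num.sqrt 3 : R) ^+ 2 = 3 by rewrite sqr_sqrtr.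
have r30 : 0 < (Num.sqrt 3 : R) by rewrite sqrtr_gt0.
have -> : (Num.sqrt 3)^-1 = tan (pi / 6 : R).
  have T0 : 0 <= tan (pi / 6 : R) by rewrite /tan divr_ge0 // ltW.
  have i0 : 0 <= (Num.sqrt 3 : R)^-1 by rewrite invr_ge0 ltW.
  apply/eqP; rewrite -(eqrXn2 (n := 2) _ i0 T0) // exprVn r3 /tan expr_div_n c2; apply/eqP.
  by have -> : sin (pi / 6 : R) ^+ 2 = 1/4; [lra|field].
by rewrite tanK // in_itv /=; apply/andP; split; lra.
Qed.

(** From sin (pi / 6) = 1 / 2 and sin x <= x. *)
Lemma pi_ge3 (R : realType) : 3 <= pi :> R.
Proof.
have pi0 := pi_gt0 R.
have c2 := cos_pi6 R.
have := cos2Dsin2 (pi / 6 : R); rewrite c2 => s2.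
have s0 : 0 < sin (pi / 6 : R) by apply: sin_gt0_pihalf; apply/andP; split; lra.
have p60 : 0 <= pi / 6 :> R by lra.
have [c _] := mean_value p60 (@is_derive_sin R).
rewrite sin0 !subr0 => E.
have : sin (pi / 6 : R) = 1 / 2 by nra.
have := cos_le1 c; nra.
Qed.

(** The difference of the two sides has a derivative with the sign of a
    decreasing function, so it is least at an end of the interval, and it
    vanishes at 0. *)
Lemma atan_le_rational (R : realType) (c k t1 : R) : 0 <= c -> 0 <= k -> 0 <= t1 ->
  k * atan t1 <= c * t1 / (1 + t1 ^+ 2) ->
  forall t, 0 <= t <= t1 -> k * atan t <= c * t / (1 + t ^+ 2).
Proof.
move=> c0 k0 t10 h t ht; rewrite -subr_ge0.
pose g (x : R) := c * x / (1 + x ^+ 2) - k * atan x.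
have q0 (x : R) : 0 < 1 + x ^+ 2 by rewrite ltr_pwDl // sqr_ge0.
apply: (@unimodal_ge0 R g (fun x => c * (1 - x ^+ 2) - k * (1 + x ^+ 2)) (fun x =>
  ((1 + x ^+ 2) ^+ 2)^-1) 0 t1) => //.
- move=> x; rewrite /g.
  have nz : 1 + x ^+ 2 != 0 by rewrite gt_eqF.
  by apply: is_derive_eq; rewrite /GRing.scale /=; field.
- by move=> x; rewrite invr_gt0 exprn_gt0.
- move=> x y x0 xy yt.
  have xy2 : 0 <= y ^+ 2 - x ^+ 2 by rewrite subr_ge0 ler_pXn2r // nnegrE // (le_trans x0).
  have : 0 <= (c + k) * (y ^+ 2 - x ^+ 2) by rewrite mulr_ge0 // addr_ge0.
  by lra.
- by rewrite /g atan0; lra.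
- by rewrite /g subr_ge0.
Qed.

(** Equality holds at both ends of [0, 1]. The sign of the derivative of the
    difference is that of (2 + x + x^2)^2 - pi (1 + 2 x) (1 + x^2), which is
    decreasing on [0, 1] already when pi is replaced by its lower bound 3. *)
Lemma atan_lower (R : realType) (c : R) : 0 <= c <= 1 ->
  pi * (1 / 2 - 1 / (2 + c + c ^+ 2)) <= atan c.
Proof.
move=> hc; rewrite -subr_ge0.
have pi3 := pi_ge3 R.
have d0 (x : R) : 0 < 2 + x + x ^+ 2 by have := sqr_ge0 (x + 1 / 2); lra.
have q0 (x : R) : 0 < 1 + x ^+ 2 by rewrite ltr_pwDl // sqr_ge0.
pose g (x : R) := atan x - pi * (1 / 2 - 1 / (2 + x + x ^+ 2)).
pose s (x : R) := (2 + x + x ^+ 2) ^+ 2 - pi * ((1 + 2 * x) * (1 + x ^+ 2)).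
pose p (x : R) := ((1 + x ^+ 2) * (2 + x + x ^+ 2) ^+ 2)^-1.
change (0 <= g c).
have g0 : 0 <= g 0 by rewrite /g atan0 expr0n /= !addr0 subrr mulr0 subrr.
have g1 : 0 <= g 1.
  by rewrite /g atan1; have -> : 2 + 1 + 1 ^+ 2 = 4 :> R by [ring]; lra.
apply: (@unimodal_ge0 R g s p 0 1 _ _ _ g0 g1 c hc).
- move=> x; rewrite /s /p; rewrite /g.
  have nz : 1 + x ^+ 2 != 0 by rewrite gt_eqF.
  have dz : 2 + x + x ^+ 2 != 0 by rewrite gt_eqF.
  by apply: is_derive_eq; rewrite /GRing.scale /=; field; rewrite dz nz.
- by move=> x; rewrite /p invr_gt0 mulr_gt0 // exprn_gt0.
- move=> x y x0 xy y1; rewrite /s.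
  have B : 0 <= (1 + 2 * y) * (1 + y ^+ 2) - (1 + 2 * x) * (1 + x ^+ 2).
    have -> : (1 + 2 * y) * (1 + y ^+ 2) - (1 + 2 * x) * (1 + x ^+ 2) =
      (y - x) * (2 + (x + y) + 2 * (x ^+ 2 + x * y + y ^+ 2)) by ring.
    apply: mulr_ge0; first lra.
    have : 0 <= x * y by rewrite mulr_ge0 // (le_trans x0).
    by have := sqr_ge0 x; have := sqr_ge0 y; lra.
  have : 3 * ((1 + 2 * y) * (1 + y ^+ 2) - (1 + 2 * x) * (1 + x ^+ 2)) <=
    pi * ((1 + 2 * y) * (1 + y ^+ 2) - (1 + 2 * x) * (1 + x ^+ 2)) by rewrite ler_wpM2r.
  suff : 0 <= (y - x) * (2 - 2 * (x + y) + 4 * (x ^+ 2 + x * y + y ^+ 2) - (x ^+ 3 + x ^+ 2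
    * y + x * y ^+ 2 + y ^+ 3)) by lra.
  apply: mulr_ge0; first lra.
  have xy0 : 0 <= x * y by rewrite mulr_ge0 // (le_trans x0).
  have y0 : 0 <= y by rewrite (le_trans x0).
  have x1 : x <= 1 by rewrite (le_trans xy).
  have e1 : 0 <= x ^+ 2 * (1 - x) by rewrite mulr_ge0 ?sqr_ge0 ?subr_ge0.
  have e2 : 0 <= y ^+ 2 * (1 - y) by rewrite mulr_ge0 ?sqr_ge0 ?subr_ge0.
  have e3 : 0 <= (x * y) * (1 - x) by rewrite mulr_ge0 ?subr_ge0.
  have e4 : 0 <= (x * y) * (1 - y) by rewrite mulr_ge0 ?subr_ge0.
  have e5 := sqr_ge0 (x + y - 1); have e6 := sqr_ge0 (x - y).
  have e7 := sqr_ge0 x; have e8 := sqr_ge0 y.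
  lra.
Qed.

(** Three numbers whose pairwise products sum to 1 are the cotangents of the
    angles of a triangle; each of these angles is pi / 2 minus an
    arctangent. *)
Lemma atan_sum (R : realType) (a b c : R) : 0 <= a <= 1 -> 0 <= b <= 1 -> 0 <= c <= 1 ->
  a * b + b * c + c * a = 1 -> atan a + atan b = pi / 2 - atan c.
Proof.
move=> ha hb hc E.
have pi0 := pi_gt0 R.
have bd (x : R) : 0 <= x <= 1 -> 0 <= atan x <= pi / 4.
  by move=> /andP[x0 x1]; rewrite -[X in X <= _](@atan0 R) -atan1 !le_atan.
have := bd _ ha; have := bd _ hb; have := bd _ hc => /andP[c0 c1] /andP[b0 b1] /andP[a0 a1].
suff : atan a + atan b + atan c = pi / 2 by lra.
apply: cos_inj; rewrite ?in_itv /=; [apply/andP; split; lra..|].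
have cp (x : R) : 0 <= atan x <= pi / 4 -> 0 < cos (atan x).
  by move=> /andP[? ?]; apply: cos_gt0_pihalf; apply/andP; split; lra.
have tE (x : R) : 0 < cos (atan x) -> sin (atan x) = x * cos (atan x).
  by move=> h; rewrite -[X in _ = X * _]atanK /tan mulfVK // gt_eqF.
rewrite cos_pihalf cosD cosD sinD !tE; try (by apply: cp; apply/andP; split).
move: (cos (atan a)) (cos (atan b)) (cos (atan c)) => u v w.
have -> : (u * v - a * u * (b * v)) * w - (a * u * v + u * (b * v)) * (c * w) =
  u * v * w * (1 - (a * b + b * c + c * a)) by ring.
by rewrite E subrr mulr0.
Qed.

(** * The two cell estimates *)

(** In terms of the cotangents tj, tk, c of the angles of the triangle 0, a,
    b, and of twice its area q, the bound on the sum of squares reads 4 <= q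
    (tj + tk + c). The other hypotheses put all cotangents in (0, 1): sides of
    length at least sqrt 2 in a circle of radius less than 1 face angles above
    pi / 4. The left side is 1/2 - atan c / pi, at most 1 / (2 + c + c^2), and
    the right side is q (1 + tj tk) / 8. After eliminating q and tj tk the
    difference is (2 + c^2) (2 - (tj + tk) (1 + c)), up to a positive factor,
    and its second factor is (1 - tj) (1 - tk). *)
Lemma square_vertex_gain (R : realType) (a b : plane R) :
  2 <= sqnorm a -> 2 <= sqnorm b -> 2 <= sqdist a b -> 8 <= sqnorm a + sqnorm b + sqdist a b ->
  cross a b != 0 -> vertex_inside 1 a b ->
  pi^-1 * (atan (vertex_slope a b) + atan (vertex_slope b a)) <=
    (sqnorm a * vertex_slope a b + sqnorm b * vertex_slope b a) / 8.
Proof.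
rewrite sqdistE => x2 y2 d2 s8 c0.
have := cross_sqr a b.
rewrite /vertex_inside /vertex_slope (crossC b a) normrN (dot2C b a).
rewrite -(real_normK (num_real (cross a b))).
have : 0 < `|cross a b| by rewrite normr_gt0.
move: x2 y2 d2 s8; set x := sqnorm a; set y := sqnorm b; set p := dot2 a b; move: `|cross a b| => q.
move=> x2 y2 d2 s8 q0 qE; rewrite mulr1.
pose tj := (y - p) / q; pose tk := (x - p) / q; pose c := p / q.
rewrite -/tj -/tk => m.
have yE : y = q * (tj + c) by rewrite /tj /c; field; rewrite gt_eqF.
have xE : x = q * (tk + c) by rewrite /tk /c; field; rewrite gt_eqF.
have pE : p = q * c by rewrite /c; field; rewrite gt_eqF.
have tE : tj * tk + tk * c + c * tj = 1.
  have : q ^+ 2 * (tj * tk + tk * c + c * tj) = q ^+ 2 * 1.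
    by rewrite mulr1 [RHS]qE [in RHS]xE [in RHS]yE [in RHS]pE; ring.
  by apply: mulfI; rewrite expf_neq0 // gt_eqF.
clearbody tj tk c.
have m' : q * (tk + c) * ((tj + tk) * (tj + c)) < 4.
  by move: m; rewrite xE (_ : 1 + tj ^+ 2 = (tj + tk) * (tj + c)) // -tE; ring.
have dE : x + y - 2 * p = q * (tj + tk) by rewrite xE yE pE; ring.
rewrite dE in d2 s8; rewrite xE in x2; rewrite yE in y2.
have A1 : 0 < tk + c by rewrite -(pmulr_rgt0 _ q0); lra.
have A2 : 0 < tj + c by rewrite -(pmulr_rgt0 _ q0); lra.
have A3 : 0 < tj + tk by rewrite -(pmulr_rgt0 _ q0); lra.
have u1 : (tj + tk) * (tj + c) < 2.
  have h : 2 * ((tj + tk) * (tj + c)) <= q * (tk + c) * ((tj + tk) * (tj + c))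
    by rewrite ler_wpM2r // mulr_ge0 // ltW.
  lra.
have u2 : (tk + c) * (tj + tk) < 2.
  have h : 2 * ((tk + c) * (tj + tk)) <= q * (tj + c) * ((tk + c) * (tj + tk))
    by rewrite ler_wpM2r // mulr_ge0 // ltW.
  lra.
have u3 : (tk + c) * (tj + c) < 2.
  have h : 2 * ((tk + c) * (tj + c)) <= q * (tj + tk) * ((tk + c) * (tj + c))
    by rewrite ler_wpM2r // mulr_ge0 // ltW.
  lra.
have lt1 (u : R) : u ^+ 2 < 1 -> -1 < u /\ u < 1 by move=> h; split; nra.
have [_ tj1] : -1 < tj /\ tj < 1 by apply: lt1; lra.
have [_ tk1] : -1 < tk /\ tk < 1 by apply: lt1; lra.
have [_ c1] : -1 < c /\ c < 1 by apply: lt1; lra.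
(* sides are shorter than 2 and their squares sum to at least 8, hence no angle
   is obtuse *)
have side1 : q * (tk + c) < 4.
  have h : q * (tk + c) * 1 <= q * (tk + c) * ((tj + tk) * (tj + c)).
    rewrite ler_wpM2l //; first by lra.
    rewrite -tE; have := sqr_ge0 tj; lra.
  lra.
have side2 : q * (tj + c) < 4.
  have h : q * (tj + c) * 1 <= q * (tj + c) * ((tj + tk) * (tk + c)).
    rewrite ler_wpM2l //; first by lra.
    rewrite -tE; have := sqr_ge0 tk; lra.
  lra.
have side3 : q * (tj + tk) < 4.
  have h : q * (tj + tk) * 1 <= q * (tj + tk) * ((tj + c) * (tk + c)).
    rewrite ler_wpM2l //; first by lra.
    rewrite -tE; have := sqr_ge0 c; lra.
  lra.
have c0' : 0 < c by rewrite -(pmulr_rgt0 _ q0); lra.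
have tj0 : 0 < tj by rewrite -(pmulr_rgt0 _ q0); lra.
have tk0 : 0 < tk by rewrite -(pmulr_rgt0 _ q0); lra.
rewrite (@atan_sum R tj tk c) ?tE //; try (by apply/andP; split; apply: ltW).
have hc : 0 <= c <= 1 by apply/andP; split; apply: ltW.
have pi0 := pi_gt0 R.
have al := atan_lower hc.
have d0 : 0 < 2 + c + c ^+ 2 by have := sqr_ge0 c; lra.
apply: (@le_trans _ _ (1 / (2 + c + c ^+ 2))).
  rewrite ler_pdivrMl //; lra.
rewrite ler_pdivrMr //.
have -> : x * tj + y * tk = q * (1 + tj * tk) by rewrite xE yE -[in RHS]tE; ring.
have q4 : 4 <= q * (tj + tk + c) by lra.
have jk1 : 0 <= (1 - tj) * (1 - tk) by rewrite mulr_ge0 // subr_ge0 ltW.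
have s0 : 0 < tj + tk + c by lra.
have q4' : 4 / (tj + tk + c) <= q by rewrite ler_pdivrMr.
have tt : 0 <= 1 + tj * tk by rewrite addr_ge0 // mulr_ge0 // ltW.
have : 4 / (tj + tk + c) * ((1 + tj * tk) * (2 + c + c ^+ 2)) <=
  q * ((1 + tj * tk) * (2 + c + c ^+ 2)).
  by rewrite ler_wpM2r // mulr_ge0 // ltW.
suff : 8 <= 4 / (tj + tk + c) * ((1 + tj * tk) * (2 + c + c ^+ 2)) by lra.
rewrite mulrAC ler_pdivlMr //.
have cjk : 0 <= (2 + c ^+ 2) * (2 - (tj + tk) * (1 + c)).
  rewrite mulr_ge0 //; first by have := sqr_ge0 c; lra.
  lra.
have -> : tj * tk = 1 - c * (tj + tk) by rewrite -tE; ring.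
lra.
Qed.

(** Since |a|^2 (1 + t^2) = 4 r2 for t = cap_slope, the claim is a
    one-variable inequality in t. It holds on [0, t1] as soon as it holds at
    t1, by atan_le_rational, and t1 is the slope for the closest admissible
    a. *)
Lemma cap_gain_le (R : realType) (r2 k t1 : R) (a : plane R) :
  0 <= r2 -> 0 <= k -> 0 <= t1 -> 0 < sqnorm a < 4 * r2 -> 4 * r2 <= sqnorm a * (1 + t1 ^+ 2) ->
  k * atan t1 <= r2 / 2 * t1 / (1 + t1 ^+ 2) ->
  k * atan (cap_slope r2 a) <= sqnorm a * cap_slope r2 a / 8.
Proof.
move=> r0 k0 t10 /andP[a0 a4] at1 h.
have t0 : 0 <= cap_slope r2 a <= t1.
  rewrite /cap_slope sqrtr_ge0 andTb -[X in _ <= X](ger0_norm t10) -sqrtr_sqr ler_wsqrtr //.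
  by rewrite lerBlDr ler_pdivrMr //; lra.
have s2 : cap_slope r2 a ^+ 2 = 4 * r2 / sqnorm a - 1.
  by rewrite sqr_sqrtr // subr_ge0 ler_pdivlMr // mul1r ltW.
have c0 : 0 <= r2 / 2 by rewrite divr_ge0.
have := atan_le_rational c0 k0 t10 h t0.
set t := cap_slope r2 a in s2 *; rewrite s2.
have -> : 1 + (4 * r2 / sqnorm a - 1) = 4 * r2 / sqnorm a by ring.
have r0' : 0 < r2 by lra.
suff -> : r2 / 2 * t / (4 * r2 / sqnorm a) = sqnorm a * t / 8 by [].
by field; rewrite !gt_eqF.
Qed.

(** At least 1 / pi per radian: a wedge ending on the circle has slope at most
    1, the slope of the side of an inscribed square, where equality holds. *)
Lemma mu2_cell_square (R : realType) (n : nat) (q : 'I_n -> plane R) :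
  (forall j, 2 <= sqnorm (q j) < 4) ->
  (forall j k, j != k -> 2 <= sqdist (q j) (q k)) ->
  (forall j k, j != k -> 8 <= sqnorm (q j) + sqnorm (q k) + sqdist (q j) (q k)) ->
  (forall j k l, j != k -> j != l -> k != l ->
     8 <= sqdist (q j) (q k) + sqdist (q j) (q l) + sqdist (q k) (q l)) ->
  (2%:E <= @mu2 R (cell q 1))%E.
Proof.
move=> H1 H2 H3 H4.
have pi0 := pi_gt0 R.
have -> : 2 = 2 * pi * pi^-1 :> R by rewrite mulfK // gt_eqF.
apply: mu2_cell => //.
- by move=> j; have /andP[a b] := H1 j; apply/andP; split; lra.
- move=> j k jk; have /andP[a b] := H1 j; have /andP[a' b'] := H1 k.
  have := H2 _ _ jk; rewrite sqdistE; have := H3 _ _ jk; rewrite sqdistE; lra.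
- move=> j k l jk jl kl v v1 vj vk; rewrite ltNge; apply/negP => vl.
  have := H4 _ _ _ jk jl kl; have := H3 _ _ jk; have := H3 _ _ jl; have := H3 _ _ kl.
  (* For the four points 0, q j, q k, q l, the sum of the six squared distances
     is at most 4 times that of the squared distances to v, which is less than
     16.  But each of the four triples contributes at least 8, and each pair is
     in two triples. *)
  pose w : plane R := ((q j).1 + (q k).1 + (q l).1 - 4 * v.1, (q j).2 + (q k).2 + (q l).2
    - 4 * v.2).
  have := sqnorm_ge0 w.
  move: v1 vj vk vl; rewrite /w /sqdist /sqnorm /dot2 /=; clear w.
  move: (q j) (q k) (q l) v => [a1 a2] [b1 b2] [c1 c2] [v1 v2] /=; lra.
- move=> j; have /andP[a b] := H1 j.
  apply: (@cap_gain_le _ 1 _ 1); rewrite ?invr_ge0 ?(ltW pi0) //; first by apply/andP; split; lra.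
    by lra.
  rewrite atan1 expr1n mulr1; rewrite mulrA mulVf ?(gt_eqF pi0) //.
  by rewrite ler_pdivlMr; lra.
- move=> j k jk c0 m; have /andP[a b] := H1 j; have /andP[a' b'] := H1 k.
  apply: square_vertex_gain => //; [exact: H2|exact: H3].
- by rewrite invr_ge0 ltW //= ler_pdivlMr // ler_pdivrMl; have := pi_ge3 R; lra.
Qed.

(** The extreme slope is 1 / sqrt 3, that of the regular hexagon inscribed in
    the circle. *)
Lemma mu2_cell_triangular (R : realType) (n : nat) (q : 'I_n -> plane R) :
  (forall j, 8 / 3 <= sqnorm (q j) < 4 * (8 / 9)) ->
  (forall j k, j != k -> 8 / 3 <= sqdist (q j) (q k)) ->
  ((4 / Num.sqrt 3)%:E <= @mu2 R (cell q (8 / 9)))%E.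
Proof.
move=> H1 H2.
have pi0 := pi_gt0 R.
have r30 : 0 < (Num.sqrt 3 : R) by rewrite sqrtr_gt0.
have r3 : (Num.sqrt 3 : R) ^+ 2 = 3 by rewrite sqr_sqrtr.
have kE (p s : R) : 0 < p -> 0 < s -> 4 / s = 2 * p * (2 / (p * s)).
  by move=> p0 s0; field; rewrite !gt_eqF.
rewrite (kE _ _ pi0 r30).
(* three points pairwise at squared distance at least 8/3 have squared
   circumradius at least 8/9 *)
have nomeet j k (v : plane R) : j != k -> sqnorm v < 8 / 9 ->
  2 * dot2 v (q j) = sqnorm (q j) -> 2 * dot2 v (q k) = sqnorm (q k) -> False.
  move=> jk.
  have /andP[a b] := H1 j; have /andP[a' b'] := H1 k; have := H2 _ _ jk; move: a a'.
  pose w : plane R := ((q j).1 + (q k).1 - 3 * v.1, (q j).2 + (q k).2 - 3 * v.2).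
  have := sqnorm_ge0 w.
  rewrite /w /sqdist /sqnorm /dot2 /=; clear w b b'.
  move: (q j) (q k) v => [a1 a2] [b1 b2] [v1 v2] /=; lra.
have circ j k : j != k -> cross (q j) (q k) != 0 -> vertex_inside (8 / 9) (q j) (q k) -> False.
  move=> jk c0 m.
  have /andP[x0 _] := H1 j.
  have x0' : 0 < sqnorm (q j) by lra.
  pose s := 0 < cross (q j) (q k).
  have cs : 0 < orient R s * cross (q j) (q k).
    rewrite /s /orient; have [h|h] := ltP 0 (cross (q j) (q k)); first by lra.
    by have : cross (q j) (q k) < 0; [rewrite lt_neqAle c0|lra].
  have [v vE] := frame_ex s 1 (vertex_slope (q j) (q k)) x0'.
  apply: (nomeet j k v jk).
  - by rewrite (sqnorm_frame v s x0') vE /=; move: m; rewrite /vertex_inside; lra.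
  - by rewrite (dot2_frame _ _ s x0') vE /= cross_id !mulr0 addr0 mul1r dot2_id.
  - by rewrite (dot2_frame _ _ s x0') vE /= (vertex_slopeE cs) mulfVK ?gt_eqF //; ring.
apply: (@mu2_cell _ _ q (8 / 9) (2 / (pi * Num.sqrt 3))) => //.
- by move=> j; have /andP[a b] := H1 j; apply/andP; split; lra.
- move=> j k jk; have /andP[a b] := H1 j; have /andP[a' b'] := H1 k.
  have := H2 _ _ jk; rewrite sqdistE; lra.
- by move=> j k l jk jl kl v v1 vj vk; case: (nomeet j k v).
- move=> j; have /andP[a b] := H1 j.
  have k0 : 0 <= 2 / (pi * Num.sqrt 3) :> R by rewrite divr_ge0 // mulr_ge0 // ltW.
  have t0 : 0 <= (Num.sqrt 3)^-1 :> R by rewrite invr_ge0 ltW.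
  apply: (@cap_gain_le _ _ _ (Num.sqrt 3)^-1) => //; rewrite ?exprVn ?r3.
  + by apply/andP; split; lra.
  + by lra.
  + rewrite atan_sqrt3 le_eqVlt; apply/orP; left; apply/eqP.
    have E (p s : R) : 0 < p -> 0 < s -> 2 / (p * s) * (p / 6) = 8 / 9 / 2 / s / (1 + 3^-1).
      by move=> p0 s0; field; rewrite !gt_eqF.
    exact: E.
- by move=> j k jk c0 m; case: (circ j k).
- have : 1 <= (Num.sqrt 3 : R) by rewrite -[X in X <= _]sqrtr1 ler_wsqrtr //; lra.
  move=> s1; have pi3 := pi_ge3 R.
  have s32 : 3 / 2 <= (Num.sqrt 3 : R) by nra.
  rewrite divr_ge0 ?mulr_ge0 ?(ltW pi0) ?(ltW r30) //= ler_pdivrMr ?mulr_gt0 //.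
  have : 3 * (3 / 2) <= pi * (Num.sqrt 3 : R) by apply: ler_pM => //; lra.
  lra.
Qed.

(** * Volume of balls in dimension four *)

Definition space4 (R : realType) :=
  (measurableTypeR R * measurableTypeR R * measurableTypeR R * measurableTypeR R)%type.

Definition reassoc (R : realType) (z : plane R * plane R) : space4 R :=
  (z.1.1, z.1.2, z.2.1, z.2.2).

(** Fubini, regrouping four coordinates as two planes. *)
Lemma vol_reassoc (R : realType) (A : set (space4 R)) : measurable A ->
  (leb R \x leb R \x leb R \x leb R)%E A = (@mu2 R \x @mu2 R)%E (@reassoc R @^-1` A).
Proof.
move=> mA; rewrite -mu2_def.
pose f (z : plane R * measurableTypeR R) := leb R (xsection A z).
have mf : measurable_fun setT f by exact: (measurable_fun_xsection (leb R) mA).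
have f0 z : (0 <= f z)%E by exact: measure_ge0.
transitivity (\int[(@mu2 R \x leb R)%E]_z f z)%E; first by [].
have -> := fubini_tonelli1 (m1 := @mu2 R) (m2 := leb R) f mf f0.
rewrite mu4_xsection; apply: eq_integral => -[x y] _.
rewrite mu2_xsection; apply: eq_integral => c _; rewrite /f.
congr (leb R _); apply/seteqP; split=> d /set_mem h.
  by apply/mem_set; apply/mem_set; exact: h.
by apply/mem_set; move/set_mem: h.
Qed.

Definition closed_disc (R : realType) (r2 : R) : set (plane R) := [set z | sqnorm z <= r2].

Lemma measurable_closed_disc (R : realType) (r2 : R) : measurable (closed_disc r2).
Proof. by apply: measurable_set_le; [exact: measurable_sqnorm|mfun]. Qed.

Lemma mu2_closed_disc (R : realType) (r2 : R) : 0 <= r2 -> @mu2 R (closed_disc r2) = (r2 * pi)%:E.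
Proof.
move=> r0; have pi0 := pi_gt0 R.
apply/eqP; rewrite eq_le; apply/andP; split.
  apply/lee_addgt0Pr => e e0.
  apply: (@le_trans _ _ (@mu2 R (disc (r2 + e / pi)))).
    apply: le_measure; rewrite ?inE; [exact: measurable_closed_disc|exact: measurable_disc|].
    by move=> z; rewrite /closed_disc /disc /= => /le_lt_trans; apply; rewrite ltrDl divr_gt0.
  rewrite mu2_disc; last by rewrite ltr_wpDl // divr_gt0.
  by rewrite -EFinD lee_fin mulrDl divfK ?gt_eqF.
have [r1|r1] := ltP 0 r2; last first.
  by have -> : r2 = 0; [lra|rewrite mul0r measure_ge0].
rewrite -mu2_disc //; apply: le_measure; rewrite ?inE;
  [exact: measurable_disc|exact: measurable_closed_disc|].
by move=> z /ltW.
Qed.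

Definition ball4 (R : realType) (r2 : R) : set (plane R * plane R) :=
  [set z | sqnorm z.1 + sqnorm z.2 <= r2].

Lemma measurable_ball4 (R : realType) (r2 : R) : measurable (ball4 r2).
Proof.
apply: measurable_set_le; last by mfun.
by apply: measurable_funD; apply: measurableT_comp => //; exact: measurable_sqnorm.
Qed.

(** The fibre of the ball over a point z of the first plane is a disc of area
    pi (r2 - |z|^2). This is pi times the length of the fibre of the solid E
    between the plane and a paraboloid, and E is computed by its horizontal
    sections, which are again discs. *)
Lemma mu4_ball (R : realType) (r2 : R) : 0 <= r2 ->
  (@mu2 R \x @mu2 R)%E (ball4 r2) = (pi ^+ 2 / 2 * r2 ^+ 2)%:E.
Proof.
move=> r0; have pi0 := pi_gt0 R.
pose E : set (plane R * measurableTypeR R) := [set z | 0 <= z.2 /\ sqnorm z.1 + z.2 <= r2].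
have mE : measurable E.
  have -> : E = [set z | 0 <= z.2] `&` [set z | sqnorm z.1 + z.2 <= r2] by [].
  have m1 : measurable_fun (setT : set (plane R * measurableTypeR R)) (fun z => sqnorm z.1).
    exact: measurableT_comp (@measurable_sqnorm R) measurable_fst.
  by apply: measurableI; apply: measurable_set_le; mfun; exact: m1.
have E1 : (@mu2 R \x @mu2 R)%E (ball4 r2) = (pi%:E * (@mu2 R \x leb R) E)%E.
  have mx : measurable_fun setT (fun z => leb R (xsection E z)) by exact: measurable_fun_xsection.
  have -> : (@mu2 R \x leb R)%E E = (\int[@mu2 R]_z leb R (xsection E z))%E by [].
  rewrite mu4_xsection -ge0_integralZl ?lee_fin ?(ltW pi0) //.
  apply: eq_integral => z _.
  have [zr|zr] := leP (sqnorm z) r2.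
    rewrite (_ : xsection _ z = closed_disc (r2 - sqnorm z)); last first.
      by apply/seteqP; split=> w; rewrite /xsection /= inE /ball4 /closed_disc /=; lra.
    rewrite mu2_closed_disc ?subr_ge0 //= (_ : xsection _ z = [set` `[0, (r2 - sqnorm z)]]);
      last first.
      apply/seteqP; split=> w; rewrite /xsection /= inE /E /= in_itv /=; first by case=> -> /=; lra.
      by move=> /andP[? ?]; split; lra.
    rewrite lebesgue_measure_itv /= lte_fin subr_gt0; case: ltP => h;
      rewrite -?EFinB -?EFinM ?subr0.
      by congr (_%:E); ring.
    have -> : sqnorm z = r2 by apply/eqP; rewrite eq_le zr h.
    by rewrite subrr mul0r ?mule0 ?mulr0.
  rewrite (_ : xsection _ z = set0); last first.
    by apply/seteqP; split=> w //; rewrite /xsection /= inE /ball4 /=; have := sqnorm_ge0 w; lra.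
  rewrite /= (_ : xsection _ z = set0) ?measure0 ?mule0 //.
  by apply/seteqP; split=> w //; rewrite /xsection /= inE /E /= => -[]; lra.
rewrite E1.
have E2 : (@mu2 R \x leb R)%E E = (\int[leb R]_y (@mu2 R (ysection E y)))%E.
  exact: (product_measure_ysection (@mu2 R) (leb R)).
have cf : continuous (fun x : R => (r2 - x) * pi).
  by move=> x; apply: cvgM; [apply: cvgB; [exact: cvg_cst|exact: cvg_id]|exact: cvg_cst].
have E3 : (\int[leb R]_y (@mu2 R (ysection E y)) =
  \int[leb R]_(x in `[0%R, r2]) ((r2 - x) * pi)%:E)%E.
  rewrite [RHS]integral_mkcond; apply: eq_integral => x _.
  rewrite patchE; case: ifPn => [/set_mem /= |/negP].
    rewrite in_itv /= => /andP[x0 xr].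
    rewrite (_ : ysection _ x = closed_disc (r2 - x)); first by rewrite mu2_closed_disc ?subr_ge0.
    by apply/seteqP; split=> w; rewrite /ysection /= inE /E /closed_disc /=;
      [case; lra|split=> //; lra].
  rewrite inE /= in_itv /= => xab.
  rewrite (_ : ysection _ _ = set0) ?measure0 //.
  apply/seteqP; split=> w //; rewrite /ysection /= inE /E /= => -[x0 xr]; apply: xab.
  by apply/andP; split=> //; have := sqnorm_ge0 w; lra.
have dF (x : R) : is_derive x (1 : R) (fun x : R => (r2 * x - x ^+ 2 / 2) * pi) ((r2 - x) * pi).
  by apply: is_derive_eq; rewrite /GRing.scale /=; field.
rewrite E2 E3 (integral_derive r0 dF cf) -EFinM; congr (_%:E).
by rewrite expr0n /=; field.
Qed.

(** * Counting centres by disjoint towers *)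

(** A set in which finite subsets have bounded size is finite: take a largest
    one. *)
Lemma bounded_enum (T : eqType) (A : set T) (N : nat) :
  (forall s : seq T, uniq s -> (forall x, x \in s -> A x) -> (size s <= N)%N) ->
  exists2 s : seq T, uniq s & forall x, A x <-> x \in s.
Proof.
move=> h.
pose Pn n := `[< exists2 s : seq T, uniq s & (forall x, x \in s -> A x) /\ size s = n >].
have ex : exists n, Pn n by exists 0%N; apply/asboolP; exists [::].
have ub n : Pn n -> (n <= N)%N by move/asboolP => [s us [sA <-]]; exact: h.
case: (ex_maxnP ex ub) => m /asboolP [s us [sA sm]] mmax.
exists s => // x; split; last exact: sA.
move=> Ax; apply/negPn/negP => xs.
have : Pn m.+1.
  apply/asboolP; exists (x :: s); first by rewrite /= xs.
  by split; [move=> y; rewrite inE => /predU1P[->|/sA]|rewrite /= sm].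
by move/mmax; rewrite ltnn.
Qed.

Lemma int_floor_uniq (R : realType) (i j : int) (x : R) :
  i%:~R <= x < i%:~R + 1 -> j%:~R <= x < j%:~R + 1 -> i = j.
Proof.
move=> /andP[a b] /andP[c d].
have : (i%:~R : R) < (j + 1)%:~R by rewrite intrD; lra.
have : (j%:~R : R) < (i + 1)%:~R by rewrite intrD; lra.
by rewrite !ltr_int !ltzD1 => ij ji; apply/eqP; rewrite eq_le ij ji.
Qed.

Section Count.
Variables (R : realType) (T : eqType) (Y : set T) (P Q : T -> plane R) (e h r2 A0 : R).
Hypothesis h0 : 0 < h <= 2.
Hypothesis r0 : 0 < r2 <= 1.
Hypothesis A00 : 0 <= A0.
Hypothesis area : 2 * h * A0 = 8.
Hypothesis sepQ : forall y y', Y y -> Y y' -> y != y' -> 2 <= sqdist (Q y) (Q y').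

Definition relpos (y y' : T) : plane R := ((Q y').1 - (Q y).1, (Q y').2 - (Q y).2).

(** Only finite families of neighbours are mentioned, so that the cell
    estimates apply as they stand. *)
Hypothesis cellA : forall y n (f : 'I_n -> T), Y y -> injective f ->
  (forall k, [/\ Y (f k), f k != y & sqnorm (relpos y (f k)) < 4 * r2]) ->
  (A0%:E <= @mu2 R (cell (fun k => relpos y (f k)) r2))%E.

(** Truncated to the disc of squared radius r2, and centred at 0 rather than
    at Q y. *)
Definition voronoi (y : T) : set (plane R) := [set z | sqnorm z < r2 /\
  forall y', Y y' -> y' != y -> 2 * dot2 z (relpos y y') < sqnorm (relpos y y')].

Lemma relposE y y' : sqnorm (relpos y y') = sqdist (Q y) (Q y').
Proof. by rewrite /relpos /sqdist /sqnorm /=; ring. Qed.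

(** Discs of radius 1 / sqrt 2 around the points are disjoint, and those
    around points at distance less than 2 lie in the disc of radius 3; each
    takes 1/18 of its area. *)
Lemma neighbours_enum y : Y y -> exists2 s : seq T, uniq s &
  forall x, (Y x /\ x != y /\ sqnorm (relpos y x) < 4 * r2) <-> x \in s.
Proof.
move=> Yy; have /andP[r00 r1] := r0; have pi0 := pi_gt0 R.
apply: (@bounded_enum _ _ 18) => s us sA.
pose D x : set (plane R) := (fun z => (- (relpos y x).1 + z.1, - (relpos y x).2 + z.2))
  @^-1` disc (1 / 2).
have mf x : measurable_fun (setT : set (plane R)) (fun z => (- (relpos y x).1 + z.1,
  - (relpos y x).2 + z.2) : plane R).
  by mfun.
have mD x : measurable (D x) by apply: measurable_preimage_setT; [exact: mf|exact: measurable_disc].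
have muD x : @mu2 R (D x) = (1 / 2 * pi)%:E.
  by rewrite /D (mu2_shift (- (relpos y x).1, - (relpos y x).2)) ?mu2_disc //;
    exact: measurable_disc.
have DE x z : D x z -> sqnorm ((z.1 - (relpos y x).1, z.2 - (relpos y x).2) : plane R) < 1 / 2.
  by rewrite /D /= /disc /= ![- _ + _]addrC.
have := @measure_ge_disjoint _ _ R (@mu2 R) _ s D (disc 9) us mD (measurable_disc _).
rewrite /= (eq_bigr (fun=> (1 / 2 * pi)%:E)) => [|i _]; last exact: muD.
rewrite sumEFin mu2_disc // lee_fin big_const_seq count_predT iter_addr_0 => H.
have : (1 / 2 * pi) *+ size s <= 9 * (pi : R).
  apply: H => [x z /sA [_ [_ dx]]|x x' z /sA [Yx _] /sA [Yx' _]] /DE.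
    move: dx; case: (relpos y x) => d1 d2; case: z => z1 z2; rewrite /disc /sqnorm /= => dx dz.
    have := sqr_ge0 (z1 - 2 * d1); have := sqr_ge0 (z2 - 2 * d2); lra.
  move=> h1 /DE h2; apply/eqP/negPn/negP => /(sepQ Yx Yx').
  move: h1 h2; rewrite /relpos /sqdist /sqnorm /=; case: (Q x) => a1 a2; case: (Q x') => b1 b2.
  case: (Q y) => c1 c2; case: z => z1 z2 /=.
  have := sqr_ge0 (2 * z1 - (a1 - c1) - (b1 - c1)); have :=
    sqr_ge0 (2 * z2 - (a2 - c2) - (b2 - c2)); lra.
by rewrite -mulr_natr -(ler_nat R) => H'; rewrite -(ler_pM2r pi0); lra.
Qed.

(** A point at distance at least 2 sqrt r2 from the centre has its bisector
    outside the disc. *)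
Lemma voronoi_cell y : Y y -> exists n (f : 'I_n -> T), [/\ injective f,
  (forall k, [/\ Y (f k), f k != y & sqnorm (relpos y (f k)) < 4 * r2]) &
  voronoi y = cell (fun k => relpos y (f k)) r2].
Proof.
move=> Yy; have [s us sE] := neighbours_enum Yy.
exists (size s), (fun k => tnth (in_tuple s) k); split.
- exact/tuple_uniqP.
- by move=> k; have /sE [a [b c]] := mem_tnth k (in_tuple s).
apply/seteqP; split=> z [zr zK]; split=> //.
  by move=> k; have /sE [a [b c]] := mem_tnth k (in_tuple s); exact: zK.
move=> y' Yy' ny.
have [lt|ge] := ltP (sqnorm (relpos y y')) (4 * r2).
  have /tnthP [k ->] : y' \in in_tuple s by apply/sE.
  exact: zK.
move: zr ge; case: (relpos y y') => d1 d2; case: z {zK} => z1 z2; rewrite /sqnorm /dot2 /= => zr ge.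
have := sqr_ge0 (2 * z1 - d1); have := sqr_ge0 (2 * z2 - d2); lra.
Qed.

Lemma measurable_voronoi y : Y y -> measurable (voronoi y).
Proof. by move=> /voronoi_cell [n [f [_ _ ->]]]; exact: measurable_cell. Qed.

Lemma mu2_voronoi y : Y y -> (A0%:E <= @mu2 R (voronoi y))%E.
Proof. by move=> Yy; have [n [f [fi fY ->]]] := voronoi_cell Yy; exact: cellA. Qed.

(** The centre of the ball of the translate y at the lattice vector i (2, 0) +
    j (e, h), for c = (y, i, j). *)
Definition position (c : T * int * int) : plane R * plane R :=
  (((P c.1.1).1 + 2 * c.1.2%:~R + e * c.2%:~R, (P c.1.1).2 + h * c.2%:~R), Q c.1.1).

(** A fundamental domain of the lattice spanned by (2, 0) and (e, h), for
    every e. *)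
Definition brick : set (plane R) := [set` `[0, 2[] `*` [set` `[0, h[].

Definition tower (c : T * int * int) : set (plane R * plane R) :=
  [set w | brick (- (position c).1.1 + w.1, - (position c).1.2 + w.2)] `*`
  [set z | voronoi c.1.1 (- (position c).2.1 + z.1, - (position c).2.2 + z.2)].

(** Voronoi cells of different translates are disjoint, and within one
    translate the bricks tile the plane. *)
Lemma tower_inj c c' z : Y c.1.1 -> Y c'.1.1 -> tower c z -> tower c' z -> c = c'.
Proof.
case: c => [[y i] j]; case: c' => [[y' i'] j'] /= Yy Yy'.
case: z => z w; rewrite /tower /position /brick /= !in_itv /= =>
  -[[/andP[a1 a2] /andP[a3 a4]] [_ K]] [[/andP[b1 b2] /andP[b3 b4]] [_ K']].
have yy : y = y'.
  apply/eqP/negPn/negP => ne.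
  have ne' : y' != y by rewrite eq_sym.
  have := K _ Yy' ne'; have := K' _ Yy ne; rewrite /relpos /dot2 /sqnorm /=; lra.
subst y'.
have /andP[h00 _] := h0.
have jj : j = j'.
  apply: (@int_floor_uniq R _ _ ((w.1 + (z.2 - w.1) - (P y).2) / h)).
    by rewrite ler_pdivlMr // ltr_pdivrMr // mulrDl mul1r; apply/andP; split; lra.
  by rewrite ler_pdivlMr // ltr_pdivrMr // mulrDl mul1r; apply/andP; split; lra.
subst j'.
congr (_, _, _).
apply: (@int_floor_uniq R _ _ ((z.1 - (P y).1 - e * j%:~R) / 2)).
  by rewrite ler_pdivlMr // ltr_pdivrMr // mulrDl mul1r; apply/andP; split; lra.
by rewrite ler_pdivlMr // ltr_pdivrMr // mulrDl mul1r; apply/andP; split; lra.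
Qed.

Lemma measurable_brick : measurable brick.
Proof. by apply: measurableX; exact: measurable_itv. Qed.

Lemma measurable_translate (c : plane R) (A : set (plane R)) : measurable A ->
  measurable [set z : plane R | A (- c.1 + z.1, - c.2 + z.2)].
Proof.
move=> mA.
have mf : measurable_fun (setT : set (plane R)) (fun z => (- c.1 + z.1, - c.2 + z.2) :
  plane R) by mfun.
exact: measurable_preimage_setT mf mA.
Qed.

Lemma measurable_tower c : Y c.1.1 -> measurable (tower c).
Proof.
move=> Yc; apply: measurableX; apply: measurable_translate;
  [exact: measurable_brick|exact: measurable_voronoi].
Qed.

Lemma mu4_tower c : Y c.1.1 -> (8%:E <= (@mu2 R \x @mu2 R) (tower c))%E.
Proof.
move=> Yc; have /andP[h00 _] := h0.
have -> : ((@mu2 R \x @mu2 R) (tower c) = @mu2 R brick * @mu2 R (voronoi c.1.1))%E.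
  rewrite /tower (product_measure1E (@mu2 R) (@mu2 R)); first last.
  - by apply: measurable_translate; exact: measurable_voronoi.
  - by apply: measurable_translate; exact: measurable_brick.
  congr (_ * _)%E.
    by apply: (mu2_shift (- (position c).1.1, - (position c).1.2)); exact: measurable_brick.
  by apply: (mu2_shift (- (position c).2.1, - (position c).2.2)); exact: measurable_voronoi.
have -> : @mu2 R brick = (2 * h)%:E.
  rewrite mu2_setX //; try exact: measurable_itv.
  rewrite EFinM; congr (_ * _)%E; rewrite lebesgue_measure_itv /= lte_fin ?h00 -?EFinB ?subr0 //.
  by rewrite ltr0n.
rewrite -area EFinM; apply: lee_pmul => //; rewrite ?lee_fin //; last exact: mu2_voronoi.
by rewrite mulr_ge0 // ltW.
Qed.

(** A brick has diameter at most sqrt 8 and a truncated cell has radius at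
    most 1, so a tower stays within distance 3 of its centre. *)
Lemma tower_ball c rho z : 0 < rho -> sqnorm (position c).1 + sqnorm (position c).2 <= rho ^+ 2 ->
  tower c z -> ball4 ((rho + 3) ^+ 2) z.
Proof.
move=> rho0 hc; rewrite /tower /brick /voronoi /ball4; move: hc.
move: (position c) => [[p1 p2] [q1 q2]]; case: z => [[z1 z2] [w1 w2]].
rewrite /sqnorm /= !in_itv /= => hc [[/andP[a1 a2] /andP[a3 a4]] [b _]].
have /andP[h00 h2] := h0; have /andP[_ r1] := r0.
rewrite /sqnorm /= in b.
pose v1 := - p1 + z1; pose v2 := - p2 + z2; pose v3 := - q1 + w1; pose v4 := - q2 + w2.
have n9 : v1 ^+ 2 + v2 ^+ 2 + (v3 ^+ 2 + v4 ^+ 2) <= 9.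
  have : 0 <= (2 - v1) * (2 + v1) by rewrite mulr_ge0 // /v1; lra.
  have : 0 <= (2 - v2) * (2 + v2) by rewrite mulr_ge0 // /v2; lra.
  rewrite -/v3 -/v4 in b; lra.
have cs : p1 * v1 + p2 * v2 + (q1 * v3 + q2 * v4) <= 3 * rho.
  rewrite -(ler_pM2l (_ : 0 < 6 * rho)); last by rewrite mulr_gt0.
  have := sqr_ge0 (rho * v1 - 3 * p1); have := sqr_ge0 (rho * v2 - 3 * p2).
  have := sqr_ge0 (rho * v3 - 3 * q1); have := sqr_ge0 (rho * v4 - 3 * q2).
  have : rho ^+ 2 * (v1 ^+ 2 + v2 ^+ 2 + (v3 ^+ 2 + v4 ^+ 2)) <=
    rho ^+ 2 * 9 by rewrite ler_wpM2l // sqr_ge0.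
  lra.
have -> : z1 = p1 + v1 by rewrite /v1; ring.
have -> : z2 = p2 + v2 by rewrite /v2; ring.
have -> : w1 = q1 + v3 by rewrite /v3; ring.
have -> : w2 = q2 + v4 by rewrite /v4; ring.
lra.
Qed.

Lemma count_le rho (s : seq (T * int * int)) : 0 < rho -> uniq s ->
  (forall c, c \in s -> Y c.1.1 /\ sqnorm (position c).1 + sqnorm (position c).2 <= rho ^+ 2) ->
  (size s)%:R * 8 <= pi ^+ 2 / 2 * (rho + 3) ^+ 4.
Proof.
move=> rho0 us sY.
pose tw c := if c \in s then tower c else set0.
have mtw c : measurable (tw c).
  by rewrite /tw; case: ifP => // /sY [Yc _]; exact: measurable_tower.
have := @measure_ge_disjoint _ _ R (@mu2 R \x @mu2 R)%E _ s tw (ball4 ((rho + 3) ^+ 2)) us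
  mtw (measurable_ball4 _).
have r30 : 0 <= (rho + 3) ^+ 2 by rewrite sqr_ge0.
have le4 : ((@mu2 R \x @mu2 R) (ball4 ((rho + 3) ^+ 2)) <= (pi ^+ 2 / 2 * (rho + 3) ^+ 4)%:E)%E.
  by rewrite mu4_ball // -exprM.
move=> H.
have {}H : (\sum_(i <- s) (@mu2 R \x @mu2 R) (tw i) <= (pi ^+ 2 / 2 * (rho + 3) ^+ 4)%:E)%E.
  apply: (le_trans (H _ _)).
  - by move=> c z cs; rewrite /tw cs; have [_ cb] := sY _ cs; exact: tower_ball.
  - move=> c c' z cs cs'; rewrite /tw cs cs'; have [Yc _] := sY _ cs; have [Yc' _] := sY _ cs'.
    exact: tower_inj.
  exact: le4.
rewrite -lee_fin; apply: (le_trans _ H).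
rewrite mulr_natl -[X in (X%:E <= _)%E]iter_addr_0 -count_predT -(big_const_seq 0 +%R) -sumEFin.
rewrite big_seq [X in (_ <= X)%E]big_seq.
by apply: lee_sum => c cs; rewrite /tw cs; have [Yc _] := sY _ cs; exact: mu4_tower.
Qed.

(** Finiteness and the bound come from the same count, applied to arbitrary
    finite subfamilies. *)
Lemma count_enum rho : 0 < rho -> exists s : seq (T * int * int), [/\ uniq s,
  (forall c, (Y c.1.1 /\ sqnorm (position c).1 + sqnorm (position c).2 <= rho ^+ 2) <-> c \in s) &
  (size s)%:R * 8 <= pi ^+ 2 / 2 * (rho + 3) ^+ 4].
Proof.
move=> rho0.
pose A c := Y c.1.1 /\ sqnorm (position c).1 + sqnorm (position c).2 <= rho ^+ 2.
have bd (s : seq (T * int * int)) : uniq s -> (forall c, c \in s -> A c) ->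
    (size s <= Num.bound (pi ^+ 2 / 2 * (rho + 3) ^+ 4 : R))%N.
  move=> us sA; have le8 := count_le rho0 us sA.
  rewrite -(ler_nat R); apply: le_trans (ltW (archi_boundP _)).
    have := ler0n R (size s); lra.
  by rewrite mulr_ge0 ?divr_ge0 ?sqr_ge0 // exprn_ge0 //; lra.
have [s us sE] := bounded_enum bd.
by exists s; split=> //; apply: count_le => // c /sE.
Qed.

End Count.

(** * Euclidean coordinates on row vectors *)

Lemma mu4_shift (R : realType) (c : plane R * plane R) (A : set (plane R * plane R)) :
  measurable A ->
  (@mu2 R \x @mu2 R)%E ((fun z => ((- c.1.1 + z.1.1, - c.1.2 + z.1.2),
    (- c.2.1 + z.2.1, - c.2.2 + z.2.2))) @^-1` A) = (@mu2 R \x @mu2 R)%E A.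
Proof.
pose g (d z : plane R) : plane R := (- d.1 + z.1, - d.2 + z.2).
have mg d : measurable_fun setT (g d) by rewrite /g; mfun.
have gE d B : measurable B -> @mu2 R (g d @^-1` B) = @mu2 R B.
  exact: (mu2_shift (- d.1, - d.2)).
exact: (product_measure_map (mg c.1) (mg c.2) (gE _) (gE _)).
Qed.

Lemma dot4 (R : realType) (x y : 'rV[R]_4) :
  dot x y = x 0 0 * y 0 0 + x 0 1 * y 0 1 + x 0 2 * y 0 2 + x 0 3 * y 0 3.
Proof.
rewrite /dot !big_ord_recl big_ord0 addr0 !addrA.
by congr (_ + _ + _ + _); congr (x _ _ * y _ _); apply/val_inj.
Qed.

Lemma dot_ge0 (R : realType) (n : nat) (x : 'rV[R]_n) : 0 <= dot x x.
Proof. by apply: sumr_ge0 => i _; rewrite -expr2 sqr_ge0. Qed.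

Lemma enorm_sqr (R : realType) (n : nat) (x : 'rV[R]_n) : enorm x ^+ 2 = dot x x.
Proof. by rewrite sqr_sqrtr // dot_ge0. Qed.

Lemma enorm_le (R : realType) (n : nat) (x : 'rV[R]_n) (r : R) : 0 <= r ->
  (enorm x <= r) = (dot x x <= r ^+ 2).
Proof. by move=> r0; rewrite -enorm_sqr ler_pXn2r // nnegrE ?sqrtr_ge0. Qed.

Definition coords (R : realType) (x : 'rV[R]_4) : plane R * plane R :=
  ((x 0 0, x 0 1), (x 0 2, x 0 3)).

Lemma dot_coords (R : realType) (x : 'rV[R]_4) : dot x x =
  sqnorm (coords x).1 + sqnorm (coords x).2.
Proof. by rewrite dot4 /sqnorm /=; ring. Qed.

Lemma coords_vec4 (R : realType) (z : plane R * plane R) : coords (vec4 (reassoc z)) = z.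
Proof. by case: z => [[a b] [c d]]; rewrite /coords /vec4 /reassoc /= !mxE. Qed.

Lemma coordsB (R : realType) (x y : 'rV[R]_4) : coords (x - y) =
  (((coords x).1.1 - (coords y).1.1, (coords x).1.2 - (coords y).1.2),
    ((coords x).2.1 - (coords y).2.1, (coords x).2.2 - (coords y).2.2)).
Proof. by rewrite /coords /= !mxE. Qed.

Lemma measurable_vec4 (R : realType) (A : set (plane R * plane R)) : measurable A ->
  measurable (@vec4 R @^-1` (@coords R @^-1` A) : set (space4 R)).
Proof.
move=> mA.
pose f (p : space4 R) : plane R * plane R := ((p.1.1.1, p.1.1.2), (p.1.2, p.2)).
have mf : measurable_fun setT f by rewrite /f; mfun.
rewrite (_ : _ @^-1` _ = f @^-1` A); first exact: measurable_preimage_setT.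
by apply/funext => -[[[a b] c] d]; rewrite /preimage /= /coords /vec4 !mxE.
Qed.

Definition ball4_at (R : realType) (c : plane R * plane R) (r2 : R) : set (plane R * plane R) :=
 (fun z => ((- c.1.1 + z.1.1, - c.1.2 + z.1.2), (- c.2.1 + z.2.1, - c.2.2 + z.2.2))) @^-1` ball4 r2.

Lemma measurable_ball4_at (R : realType) (c : plane R * plane R) (r2 : R) :
  measurable (ball4_at c r2).
Proof.
apply: measurable_preimage_setT; last exact: measurable_ball4.
by apply: measurable_fun_pair; mfun.
Qed.

Lemma eball_coords (R : realType) (c : 'rV[R]_4) (r : R) : 0 <= r ->
  eball c r = @coords R @^-1` ball4_at (coords c) (r ^+ 2).
Proof.
move=> r0; apply/funext => x; rewrite /eball /= enorm_le // dot_coords coordsB /ball4_at /ball4 /=.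
by rewrite /coords /= ![- _ + _]addrC.
Qed.

Lemma measurable_eball (R : realType) (c : 'rV[R]_4) (r : R) : 0 <= r ->
  measurable (@vec4 R @^-1` eball c r : set (space4 R)).
Proof. by move=> r0; rewrite eball_coords //; apply: measurable_vec4;
  exact: measurable_ball4_at. Qed.

Lemma vol4_eball (R : realType) (c : 'rV[R]_4) (r : R) : 0 <= r ->
  vol4 (eball c r) = (pi ^+ 2 / 2 * r ^+ 4)%:E.
Proof.
move=> r0; rewrite /vol4 (vol_reassoc (measurable_eball c r0)) eball_coords //.
rewrite (_ : _ @^-1` _ = ball4_at (coords c) (r ^+ 2)).
  by rewrite mu4_shift ?mu4_ball ?sqr_ge0 -?exprM //; exact: measurable_ball4.
by apply/funext => z; rewrite /preimage /= coords_vec4.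
Qed.

Lemma open_dot_ball (R : realType) (c : 'rV[R]_4) : open [set x :
  'rV[R]_4 | dot (x - c) (x - c) < 1].
Proof.
have cc (i : 'I_4) : continuous (fun x : 'rV[R]_4 => x 0 i - c 0 i).
  by move=> x; apply: continuousB; [exact: coord_continuous|exact: cst_continuous].
have cf : continuous (fun x : 'rV[R]_4 => dot (x - c) (x - c)).
  have -> : (fun x : 'rV[R]_4 => dot (x - c) (x - c)) = (fun x =>
    (x 0 0 - c 0 0) * (x 0 0 - c 0 0) + (x 0 1 - c 0 1) * (x 0 1 - c 0 1) +
    (x 0 2 - c 0 2) * (x 0 2 - c 0 2) + (x 0 3 - c 0 3) * (x 0 3 - c 0 3)).
    by apply/funext => y; rewrite dot4 !mxE.
  have cmul i : continuous (fun x : 'rV[R]_4 => (x 0 i - c 0 i) * (x 0 i - c 0 i)).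
    by move=> x; exact: (continuousM (cc i x) (cc i x)).
  move=> x.
  exact: (continuousD (continuousD (continuousD (cmul 0 x) (cmul 1 x)) (cmul 2 x)) (cmul 3 x)).
have := open_comp (fun x _ => cf x) (@open_lt R 1).
by apply.
Qed.

Lemma dot_ball_interior (R : realType) (c x : 'rV[R]_4) (A : set 'rV[R]_4) :
  eball c 1 `<=` A -> dot (x - c) (x - c) < 1 -> (A^°)%classic x.
Proof.
move=> cA xc.
have sub : [set x : 'rV[R]_4 | dot (x - c) (x - c) < 1] `<=` A.
  by move=> y /= yc; apply: cA; rewrite /eball /= enorm_le // expr1n; exact: ltW.
have /interior_id oE := @open_dot_ball R c.
by apply: (interiorS sub); rewrite oE.
Qed.

(** * Isometries bringing the lattice plane to standard position *)

Lemma dotE (R : realType) (n : nat) (x y : 'rV[R]_n) : dot x y = (x *m y^T) 0 0.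
Proof. by rewrite mxE; apply: eq_bigr => i _; rewrite mxE. Qed.

Lemma dotDl (R : realType) (n : nat) (x y z : 'rV[R]_n) : dot (x + y) z = dot x z + dot y z.
Proof. by rewrite !dotE mulmxDl mxE. Qed.
Lemma dotZl (R : realType) (n : nat) (c : R) (x z : 'rV[R]_n) : dot (c *: x) z = c * dot x z.
Proof. by rewrite !dotE -scalemxAl mxE. Qed.
Lemma dot_sym (R : realType) (n : nat) (x y : 'rV[R]_n) : dot x y = dot y x.
Proof. by apply: eq_bigr => i _; rewrite mulrC. Qed.
Lemma dotDr (R : realType) (n : nat) (x y z : 'rV[R]_n) : dot z (x + y) = dot z x + dot z y.
Proof. by rewrite !(dot_sym z) dotDl. Qed.
Lemma dotZr (R : realType) (n : nat) (c : R) (x z : 'rV[R]_n) : dot z (c *: x) = c * dot z x.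
Proof. by rewrite !(dot_sym z) dotZl. Qed.
Lemma dotNl (R : realType) (n : nat) (x z : 'rV[R]_n) : dot (- x) z = - dot x z.
Proof. by rewrite -scaleN1r dotZl mulN1r. Qed.
Lemma dotNr (R : realType) (n : nat) (x z : 'rV[R]_n) : dot z (- x) = - dot z x.
Proof. by rewrite !(dot_sym z) dotNl. Qed.

Lemma dot_eq0 (R : realType) (n : nat) (x : 'rV[R]_n) : dot x x = 0 -> x = 0.
Proof.
move=> /eqP; rewrite psumr_eq0 => [/allP h|i _]; last by rewrite -expr2 sqr_ge0.
apply/rowP => i; rewrite mxE; have := h i (mem_index_enum i).
by rewrite /= mulf_eq0 orbb => /eqP.
Qed.

(** The reflection that exchanges u and v; it fixes the hyperplane of points
    equidistant from them. *)
Lemma householder (R : realType) (n : nat) (u v : 'rV[R]_n) : dot u u = dot v v ->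
  exists M : 'M[R]_n, [/\ forall x, dot (x *m M) (x *m M) = dot x x, u *m M = v &
    forall x, dot x u = dot x v -> x *m M = x].
Proof.
move=> uv; have [w0|w0] := eqVneq (dot (u - v) (u - v)) 0.
  have /eqP := dot_eq0 w0; rewrite subr_eq0 => /eqP <-.
  by exists 1%:M; split=> [x||x _]; rewrite mulmx1.
have [w wE] : exists w, w = u - v by exists (u - v).
rewrite -wE in w0; pose k := 2 / dot w w.
exists (1%:M - k *: (w^T *m w)).
have E x : x *m (1%:M - k *: (w^T *m w)) = x - (k * dot x w) *: w.
  rewrite mulmxBr mulmx1 -scalemxAr mulmxA; congr (_ - _).
  by rewrite [x *m w^T]mx11_scalar mul_scalar_mx -dotE scalerA.
have kE : k * dot w w = 2 by rewrite /k divfK.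
split=> [x||x xu]; rewrite E.
- rewrite dotDl !dotDr !dotNl !dotNr !dotZl !dotZr (dot_sym w x).
  apply/eqP; rewrite -subr_eq0; apply/eqP.
  transitivity (k * dot x w ^+ 2 * (k * dot w w - 2)); first by ring.
  by rewrite kE subrr mulr0.
- have -> : k * dot u w = 1.
    apply: (mulIf w0); rewrite mulrAC kE mul1r wE !dotDl !dotDr !dotNl !dotNr (dot_sym v u)
      uv; ring.
  by rewrite scale1r wE opprB addrC subrK.
- by rewrite wE dotDr dotNr xu subrr mulr0 scale0r subr0.
Qed.

(** Two reflections: the first moves a to its place, and the second moves the
    image of b while fixing a, since the inner products with a agree. *)
Lemma gram_frame (R : realType) (a b : 'rV[R]_4) (e h : R) :
  dot a a = 4 -> dot b b = 4 -> dot a b = 2 * e -> e ^+ 2 + h ^+ 2 = 4 ->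
  exists M : 'M[R]_4, [/\ forall x, dot (x *m M) (x *m M) = dot x x,
    coords (a *m M) = ((2, 0), (0, 0)) & coords (b *m M) = ((e, h), (0, 0))].
Proof.
move=> aa bb ab eh.
pose u : 'rV[R]_4 := vec4 (2, 0, 0, 0); pose v : 'rV[R]_4 := vec4 (e, h, 0, 0).
have uE : coords u = ((2, 0), (0, 0)) by exact: (coords_vec4 ((2, 0), (0, 0))).
have vE : coords v = ((e, h), (0, 0)) by exact: (coords_vec4 ((e, h), (0, 0))).
have uu : dot u u = 4 by rewrite dot_coords uE /sqnorm /=; ring.
have vv : dot v v = 4 by rewrite dot_coords vE /sqnorm /= -eh; ring.
have uv : dot u v = 2 * e by rewrite dot4 /u /v /vec4 !mxE /=; ring.
have [M1 [iM1 aM1 _]] := householder (etrans aa (esym uu)).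
have dotM1 x y : dot (x *m M1) (y *m M1) = dot x y.
  have := iM1 (x + y); rewrite mulmxDl !dotDl !dotDr !iM1 (dot_sym y) (dot_sym (y *m M1)); lra.
have bb1 : dot (b *m M1) (b *m M1) = dot v v by rewrite dotM1 bb vv.
have [M2 [iM2 bM2 fM2]] := householder bb1.
have uM2 : u *m M2 = u by apply: fM2; rewrite -{1}aM1 dotM1 ab uv.
exists (M1 *m M2); split=> [x||]; rewrite mulmxA ?iM2 ?iM1 //.
  by rewrite aM1 uM2.
by rewrite bM2.
Qed.

(** * Separation transverse to the lattice plane *)

(** P and Q are the components of the translation vectors along and across the
    lattice plane, in coordinates where (2, 0) and (e, h) span the
    lattice. *)
Definition lattice_sep (R : realType) (e h : R) (T : eqType) (Y : set T) (P Q : T -> plane R) :=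
  forall y y', Y y -> Y y' -> y != y' -> forall i j : int,
  4 <= sqnorm (((P y).1 - (P y').1 - 2 * i%:~R - e * j%:~R, (P y).2 - (P y').2 - h * j%:~R)
    : plane R) + sqdist (Q y) (Q y').

Definition cell_bound (R : realType) (r2 A0 : R) (T : eqType) (Y : set T) (Q : T -> plane R) :=
  forall y n (f : 'I_n -> T), Y y -> injective f ->
  (forall k, [/\ Y (f k), f k != y & sqnorm (relpos Q y (f k)) < 4 * r2]) ->
  (A0%:E <= @mu2 R (cell (fun k => relpos Q y (f k)) r2))%E.

Lemma even_near (R : realType) (x : R) : exists i : int, -1 <= x - 2 * i%:~R <= 1.
Proof.
exists (Num.floor ((x + 1) / 2)).
have := floor_itv ((x + 1) / 2); rewrite intrD => /andP[a b].
by apply/andP; split; lra.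
Qed.

Lemma sqr_le1 (R : realType) (x : R) : -1 <= x <= 1 -> x ^+ 2 <= 1.
Proof. by move=> /andP[a b]; have : 0 <= (1 - x) * (1 + x) by [rewrite mulr_ge0; lra]; lra. Qed.

(** The distances between three points on a circle of length 2 are at most 1,
    so each is at least its square, and their sum is at most 2. *)
Lemma circle_triple (R : realType) (a b : R) : exists i j k : int,
  (a - 2 * i%:~R) ^+ 2 + (b - 2 * j%:~R) ^+ 2 + (a - b - 2 * k%:~R) ^+ 2 <= 2.
Proof.
have [i ai] := even_near a; have [j bj] := even_near b.
set u := a - 2 * i%:~R in ai; set v := b - 2 * j%:~R in bj.
have E k : a - b - 2 * (i - j + k)%:~R = u - v - 2 * k%:~R.
  by rewrite /u /v !intrD intrN; ring.
have u2 := sqr_le1 ai; have v2 := sqr_le1 bj.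
move: ai bj => /andP[a1 a2] /andP[b1 b2].
suff [k hk] : exists k : int, u ^+ 2 + v ^+ 2 + (u - v - 2 * k%:~R) ^+ 2 <= 2.
  by exists i, j, (i - j + k); rewrite E.
have [d1|d1] := leP (u - v) 1; last first.
  exists 1.
  have -> : (1%:~R : R) = 1 by [].
  have : 0 <= (1 - u) * u by rewrite mulr_ge0; lra.
  have : 0 <= (1 + v) * - v by rewrite mulr_ge0; lra.
  have : 0 <= (2 - (u - v)) * (u - v - 1) by rewrite mulr_ge0; lra.
  lra.
have [d2|d2] := leP (-1) (u - v); last first.
  exists (-1).
  have -> : ((-1)%:~R : R) = -1 by [].
  have : 0 <= (1 + u) * - u by rewrite mulr_ge0; lra.
  have : 0 <= (1 - v) * v by rewrite mulr_ge0; lra.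
  have : 0 <= (2 + (u - v)) * (- (u - v) - 1) by rewrite mulr_ge0; lra.
  lra.
exists 0.
have -> : (0%:~R : R) = 0 by [].
have d12 : (u - v) ^+ 2 <= 1 by apply: sqr_le1; apply/andP.
have [u0|u0] := leP 0 u; have [v0|v0] := leP 0 v.
- have [uv|uv] := leP u v.
    have : 0 <= u * (v - u) by rewrite mulr_ge0; lra.
    lra.
  have : 0 <= v * (u - v) by rewrite mulr_ge0; lra.
  lra.
- have : 0 <= u * - v by rewrite mulr_ge0; lra.
  lra.
- have : 0 <= - u * v by rewrite mulr_ge0; lra.
  lra.
- have [uv|uv] := leP u v.
    have : 0 <= - v * (v - u) by rewrite mulr_ge0; lra.
    lra.
  have : 0 <= - u * (u - v) by rewrite mulr_ge0; lra.
  lra.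
Qed.

(** Every point is within distance 1 of an even number in each coordinate, so
    a pair can be shifted to squared distance at most 2 in the lattice plane;
    for a triple, circle_triple in each of the two coordinates leaves 3 * 4 -
    2 * 2 = 8 for the transverse distances. *)
Lemma square_sep (R : realType) (T : eqType) (Y : set T) (P Q : T -> plane R) :
  lattice_sep 0 2 Y P Q ->
  (forall y y', Y y -> Y y' -> y != y' -> 2 <= sqdist (Q y) (Q y')) /\ cell_bound 1 2 Y Q.
Proof.
move=> sep.
have pair y y' : Y y -> Y y' -> y != y' -> 2 <= sqdist (Q y) (Q y').
  move=> Yy Yy' ne.
  have [i hi] := even_near ((P y).1 - (P y').1); have [j hj] := even_near ((P y).2 - (P y').2).
  have := sep _ _ Yy Yy' ne i j; have := sqr_le1 hi; have := sqr_le1 hj;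
    rewrite /sqnorm /= mul0r subr0; lra.
have triple x y z : Y x -> Y y -> Y z -> x != y -> x != z -> y != z ->
    8 <= sqdist (Q x) (Q y) + sqdist (Q x) (Q z) + sqdist (Q y) (Q z).
  move=> Yx Yy Yz xy xz yz.
  have [i1 [j1 [k1 h1]]] := circle_triple ((P x).1 - (P z).1) ((P y).1 - (P z).1).
  have [i2 [j2 [k2 h2]]] := circle_triple ((P x).2 - (P z).2) ((P y).2 - (P z).2).
  have := sep _ _ Yx Yz xz i1 i2; have := sep _ _ Yy Yz yz j1 j2; have := sep _ _ Yx Yy xy k1 k2.
  rewrite /sqnorm /= !mul0r !subr0; lra.
split=> // y n f Yy fi fY.
have dd j k : sqdist (relpos Q y (f j)) (relpos Q y (f k)) = sqdist (Q (f j)) (Q (f k)).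
  by rewrite /sqdist /relpos /sqnorm /=; ring.
have fne j k : j != k -> f j != f k by apply: contraNneq => /fi ->.
apply: mu2_cell_square.
- move=> j; have [Yj ne lt] := fY j.
  by apply/andP; split; [rewrite relposE pair // eq_sym|lra].
- by move=> j k jk; rewrite dd; have [Yj _ _] := fY j; have [Yk _ _] := fY k;
  apply: pair => //; exact: fne.
- move=> j k jk; rewrite dd !relposE; have [Yj nj _] := fY j; have [Yk nk _] := fY k.
  by apply: triple => //; [rewrite eq_sym|rewrite eq_sym|exact: fne].
- move=> j k l jk jl kl; rewrite !dd; have [Yj _ _] := fY j; have [Yk _ _] := fY k;
  have [Yl _ _] := fY l.
  by apply: triple => //; exact: fne.
Qed.

(** 4 / 3 is the squared circumradius of the triangle with side 2. After
    reduction to the strip 0 <= w <= sqrt 3 and |u| <= 1, the point is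
    compared with 0 and with (1, sqrt 3) or (-1, sqrt 3). *)
Lemma triangular_near (R : realType) (u w : R) : exists i j : int,
  (u - 2 * i%:~R - j%:~R) ^+ 2 + (w - Num.sqrt 3 * j%:~R) ^+ 2 <= 4 / 3.
Proof.
have r30 : 0 < (Num.sqrt 3 : R) by rewrite sqrtr_gt0.
set r := Num.sqrt 3 in r30 *.
have r3 : r ^+ 2 = 3 by rewrite sqr_sqrtr.
have : exists j : int, 0 <= w - r * j%:~R <= r.
  exists (Num.floor (w / r)).
  have := floor_itv (w / r); rewrite intrD ler_pdivlMr // ltr_pdivrMr // => /andP[c d].
  by apply/andP; split; lra.
case=> j; set t := w - _ => /andP[t0 t1].
have [i hi] := even_near (u - j%:~R).
set s := u - j%:~R - 2 * i%:~R in hi.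
have sE : u - 2 * i%:~R - j%:~R = s by rewrite /s; ring.
move: hi => /andP[s1 s2].
(* a quarter of a Voronoi hexagon, by symmetry; the bisector of 0 and
   (1, sqrt 3) is x + r y = 2 *)
have key (x y : R) : 0 <= x <= 1 -> 0 <= y -> x + r * y <= 2 -> x ^+ 2 + y ^+ 2 <= 4 / 3.
  move=> /andP[x0 x1] y0 xy.
  have h : (r * y) ^+ 2 <= (2 - x) ^+ 2 by rewrite ler_pXn2r ?nnegrE ?mulr_ge0 // ?(ltW r30)
    //; lra.
  have : 0 <= x * (1 - x) by rewrite mulr_ge0; lra.
  move: h; rewrite exprMn r3; lra.
have [s0|s0] := leP 0 s; have [c|c] := leP (`|s| + r * t) 2.
- exists i, j; rewrite sE -/t; apply: key => //; first by apply/andP.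
  by rewrite ger0_norm in c.
- exists i, (j + 1).
  have E1 : u - 2 * i%:~R - (j + 1)%:~R = s - 1 by rewrite intrD -sE; ring.
  have E2 : w - r * (j + 1)%:~R = - (r - t) by rewrite intrD /t; ring.
  rewrite E1 E2 sqrrN -[(s - 1) ^+ 2]sqrrN opprB; apply: key; [apply/andP; split; lra|lra|].
  by rewrite ger0_norm // in c; lra.
- exists i, j; rewrite sE -/t -[s ^+ 2]sqrrN; apply: key => //; first by apply/andP; split; lra.
  by rewrite ltr0_norm in c.
- exists (i - 1), (j + 1).
  have E1 : u - 2 * (i - 1)%:~R - (j + 1)%:~R = 1 + s by rewrite !intrD intrN -sE; ring.
  have E2 : w - r * (j + 1)%:~R = - (r - t) by rewrite intrD /t; ring.
  rewrite E1 E2 sqrrN; apply: key; [apply/andP; split; lra|lra|].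
  by rewrite ltr0_norm // in c; lra.
Qed.

Lemma triangular_sep (R : realType) (T : eqType) (Y : set T) (P Q : T -> plane R) :
  lattice_sep 1 (Num.sqrt 3) Y P Q ->
  (forall y y', Y y -> Y y' -> y != y' -> 2 <= sqdist (Q y) (Q y')) /\
    cell_bound (8 / 9) (4 / Num.sqrt 3) Y Q.
Proof.
move=> sep.
have pair y y' : Y y -> Y y' -> y != y' -> 8 / 3 <= sqdist (Q y) (Q y').
  move=> Yy Yy' ne.
  have [i [j hij]] := triangular_near ((P y).1 - (P y').1) ((P y).2 - (P y').2).
  have := sep _ _ Yy Yy' ne i j; rewrite /sqnorm /= mul1r; lra.
split=> [y y' Yy Yy' ne|y n f Yy fi fY]; first by have := pair _ _ Yy Yy' ne; lra.
have dd j k : sqdist (relpos Q y (f j)) (relpos Q y (f k)) = sqdist (Q (f j)) (Q (f k)).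
  by rewrite /sqdist /relpos /sqnorm /=; ring.
have fne j k : j != k -> f j != f k by apply: contraNneq => /fi ->.
apply: mu2_cell_triangular.
- move=> j; have [Yj ne lt] := fY j.
  by apply/andP; split; [rewrite relposE pair // eq_sym|lra].
- by move=> j k jk; rewrite dd; have [Yj _ _] := fY j; have [Yk _ _] := fY k;
  apply: pair => //; exact: fne.
Qed.

(** * Density *)

(** The bound tends to c; explicitly, (1 + x)^4 <= 1 + 15 x on [0, 1], with x
    = k / rho. *)
Lemma limsup_le (R : realType) (f : R -> \bar R) (c k : R) : 0 <= c <= 1 -> 0 < k ->
  (forall rho, 0 < rho -> (f rho <= (c * ((rho + k) / rho) ^+ 4)%:E)%E) ->
  (limf_esup f +oo%R <= c%:E)%E.
Proof.
move=> /andP[c0 c1] k0 fb; apply/lee_addgt0Pr => eps e0.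
(* large enough for x = k / rho to satisfy x <= 1 and 15 x <= eps *)
pose M := k + 15 * k / eps.
have M0 : k < M by rewrite /M ltrDl !mulr_gt0 // invr_gt0.
apply: (@le_trans _ _ (ereal_sup (f @` [set x | M < x]))).
  apply: ereal_inf_lbound; exists [set x | M < x] => //.
  by exists M; split; [exact: num_real|].
apply: ge_ereal_sup => _ [rho /= hM <-].
have rho0 : 0 < rho by lra.
apply: (le_trans (fb _ rho0)); rewrite -EFinD lee_fin.
have -> : (rho + k) / rho = 1 + k / rho by field; rewrite gt_eqF.
set x := k / rho.
have x0 : 0 <= x by rewrite /x divr_ge0 // ltW.
have x1 : x <= 1 by rewrite /x ler_pdivrMr //; lra.
have xe : 15 * x <= eps.
  rewrite /x mulrA ler_pdivrMr // -ler_pdivrMl // mulrC (le_trans _ (ltW hM)) // /M; lra.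
have x2 : 0 <= x * (1 - x) by rewrite mulr_ge0; lra.
have x3 : 0 <= x ^+ 2 * (1 - x) by rewrite mulr_ge0 ?sqr_ge0; lra.
have x4 : 0 <= x ^+ 3 * (1 - x) by rewrite mulr_ge0 ?exprn_ge0; lra.
have p4 : (1 + x) ^+ 4 <= 1 + 15 * x.
  have -> : (1 + x) ^+ 4 = 1 + 4 * x + 6 * x ^+ 2 + 4 * x ^+ 3 + x ^+ 4 by ring.
  lra.
have : c * (1 + x) ^+ 4 <= c * (1 + 15 * x) by rewrite ler_wpM2l.
have : c * (15 * x) <= 1 * (15 * x) by rewrite ler_wpM2r //; lra.
lra.
Qed.

Section Core.
Variables (R : realType) (a b : 'rV[R]_4) (e h r2 A0 : R).
Hypothesis aa : dot a a = 4.
Hypothesis bb : dot b b = 4.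
Hypothesis ab : dot a b = 2 * e.
Hypothesis eh : e ^+ 2 + h ^+ 2 = 4.
Hypothesis h0 : 0 < h <= 2.
Hypothesis r0 : 0 < r2 <= 1.
Hypothesis A00 : 0 <= A0.
Hypothesis area : 2 * h * A0 = 8.
(** What depends on the shape of the lattice, besides the values of e, h, r2
    and A0. *)
Hypothesis sep_bound : forall (T : eqType) (Y : set T) (P Q : T ->
  plane R), lattice_sep e h Y P Q ->
  (forall y y', Y y -> Y y' -> y != y' -> 2 <= sqdist (Q y) (Q y')) /\ cell_bound r2 A0 Y Q.

Let L := unit_ball_union (lattice2 a b).
Variable F : set (set 'rV[R]_4).
Hypothesis hF : forall A, F A -> exists x : 'rV[R]_4, A = translate x L.
Hypothesis hpack : packing F.

Lemma lattice0 : lattice2 a b 0.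
Proof. by exists 0, 0; rewrite !mulr0z addr0. Qed.

Lemma translateP x z : translate x L z <->
  exists2 c, lattice2 a b c & dot (z - (x + c)) (z - (x + c)) <= 1.
Proof.
rewrite /translate /L /unit_ball_union /bigcup /eball /=; split.
  move=> [y [c /= Lc]]; rewrite enorm_le // expr1n => yc <-; exists c => //.
  by rewrite (_ : x + y - (x + c) = y - c) // opprD addrACA subrr add0r.
move=> [c Lc zc]; exists (z - x); last by rewrite addrC subrK.
by exists c => //=; rewrite enorm_le // expr1n (_ : z - x - c = z - (x + c)) // opprD addrA.
Qed.

(** Otherwise the midpoint of the two centres x and y + c would be interior to
    both translates. *)
Lemma center_sep x y : F (translate x L) -> F (translate y L) -> translate x L <> translate y L ->
  forall c, lattice2 a b c -> 4 <= dot (x - y - c) (x - y - c).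
Proof.
move=> Fx Fy ne c Lc; rewrite leNgt; apply/negP => lt4.
apply: ne; apply: (hpack Fx Fy).
pose m := 2^-1 *: (x + (y + c)).
exists m; split.
  apply: (@dot_ball_interior R x).
    move=> z; rewrite /eball /= enorm_le // expr1n => zx.
    by apply/translateP; exists 0; [exact: lattice0|rewrite addr0].
  have -> : m - x = (- 2^-1) *: (x - y - c).
    by apply/rowP => i; rewrite /m !mxE; field.
  rewrite dotZl dotZr; lra.
apply: (@dot_ball_interior R (y + c)).
  move=> z; rewrite /eball /= enorm_le // expr1n => zx.
  by apply/translateP; exists c.
have -> : m - (y + c) = 2^-1 *: (x - y - c).
  by apply/rowP => i; rewrite /m !mxE; field.
rewrite dotZl dotZr; lra.
Qed.

Lemma coords_lattice (M : 'M[R]_4) (x : 'rV[R]_4) (i j : int) :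
  coords (a *m M) = ((2, 0), (0, 0)) -> coords (b *m M) = ((e, h), (0, 0)) ->
  coords ((x + (a *~ i + b *~ j)) *m M) =
   (((coords (x *m M)).1.1 + 2 * i%:~R + e * j%:~R, (coords (x *m M)).1.2 + h * j%:~R),
     (coords (x *m M)).2).
Proof.
move=> aM bM.
have E : (x + (a *~ i + b *~ j)) *m M = x *m M + (i%:~R *: (a *m M) + j%:~R *: (b *m M)).
  by rewrite -(scaler_int i a) -(scaler_int j b) !mulmxDl -!scalemxAl.
rewrite E; move: aM bM; move: (a *m M) (b *m M) (x *m M) => u v w;
  rewrite /coords => -[a1 a2 a3 a4] [b1 b2 b3 b4].
by rewrite !mxE a1 a2 a3 a4 b1 b2 b3 b4; congr (_, _, (_, _)); rewrite /=; ring.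
Qed.

(** A ball that meets the ball of radius rho has its centre within rho + 1 of
    the origin, so the covered volume is at most the number of such centres
    times pi^2 / 2. *)
Lemma covered_bound (rho : R) : 0 < rho ->
  (covered_proportion F rho <= (pi ^+ 2 / 16 * ((rho + 4) / rho) ^+ 4)%:E)%E.
Proof.
move=> rho0.
have [M [iM aM bM]] := gram_frame aa bb ab eh.
have [g gE] : exists g : set 'rV[R]_4 -> 'rV[R]_4, forall A, F A -> A = translate (g A) L.
  exists (fun A => xget 0 [set x | A = translate x L]) => A /hF [x xE].
  by case: xgetP => [y _ yE|/(_ x)] //.
pose Y := g @` F.
have YF y : Y y -> F (translate y L) by move=> [A FA <-]; rewrite -gE.
pose P (y : 'rV[R]_4) := (coords (y *m M)).1; pose Q (y : 'rV[R]_4) := (coords (y *m M)).2.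
have sep : lattice_sep e h Y P Q.
  move=> y y' Yy Yy' ne i j.
  have net : translate y L <> translate y' L.
    move: Yy Yy' ne => [A FA <-] [A' FA' <-]; rewrite -!gE // => ne AA; move: ne.
    by rewrite AA eqxx.
  have Lc : lattice2 a b (a *~ i + b *~ j) by exists i, j.
  have := center_sep (YF _ Yy) (YF _ Yy') net Lc.
  rewrite (_ : y - y' - (a *~ i + b *~ j) = y - (y' + (a *~ i + b *~ j)));
    last by rewrite [in RHS]opprD addrA.
  rewrite -iM dot_coords mulmxBl coordsB coords_lattice // /P /Q /sqdist /sqnorm /= => H.
  apply: (le_trans H); rewrite le_eqVlt; apply/orP; left; apply/eqP; ring.
have [sepQ cellA] := sep_bound sep.
have [s [us sE sle]] := @count_enum R _ Y P Q e h r2 A0 h0 r0 A00 area sepQ cellA (rho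
  + 1) (addr_gt0 rho0 ltr01).
pose ctr (c : 'rV[R]_4 * int * int) := c.1.1 + (a *~ c.1.2 + b *~ c.2).
have posE c : sqnorm (position P Q e h c).1 + sqnorm (position P Q e h c).2 = dot (ctr c) (ctr c).
  by rewrite -iM dot_coords coords_lattice // /position.
have covE : (\bigcup_(A in F) A) `&` eball 0 rho =
  (\bigcup_(c in [set` s]) eball (ctr c) 1) `&` eball 0 rho.
  apply/seteqP; split=> z [] [].
    move=> A FA Az zr; split=> //.
    have Yg : Y (g A) by exists A.
    move: Az; rewrite (gE _ FA) => /translateP [c [i [j cE]] zc].
    exists (g A, i, j) => /=; last by rewrite /eball /= enorm_le // expr1n /ctr /= -cE.
    apply/sE; split=> //; rewrite posE /ctr /= -cE.
    move: zr; rewrite /eball /= enorm_le ?(ltW rho0) // subr0 => zr.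
    set w := g A + c in zc *; set d := z - w in zc.
    have -> : w = z - d by rewrite /d opprB addrC subrK.
    have : 0 <= dot (rho *: d + z) (rho *: d + z) by exact: dot_ge0.
    rewrite !dotDl !dotDr !dotNl !dotNr !dotZl !dotZr (dot_sym z d).
    have : rho ^+ 2 * dot d d <= rho ^+ 2 * 1 by rewrite ler_wpM2l // sqr_ge0.
    move=> u1 u2.
    have u3 : - (2 * dot d z) <= 2 * rho by rewrite -(ler_pM2l rho0); lra.
    lra.
  move=> [[y i] j] /= /sE [Yy _] zc zr; split=> //.
  exists (translate y L); first exact: YF.
  apply/translateP; exists (a *~ i + b *~ j); first by exists i, j.
  by move: zc; rewrite /eball /= enorm_le // expr1n.
have pi0 := pi_gt0 R.
have mb c : measurable (@vec4 R @^-1` eball (ctr c) 1 : set (space4 R)) by exact: measurable_eball.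
have mr : measurable (@vec4 R @^-1` eball 0 rho : set (space4 R))
  by apply: measurable_eball; exact: ltW.
have covle : (vol4 ((\bigcup_(A in F) A) `&` eball 0 rho) <= ((size s)%:R * (pi ^+ 2 / 2))%:E)%E.
  rewrite covE /vol4.
  pose V : {measure set (space4 R) -> \bar R} := (leb R \x leb R \x leb R \x leb R)%E.
  have := @measure_le_cover _ _ R V _ s (fun c => @vec4 R @^-1` eball (ctr c) 1)
    (@vec4 R @^-1` ((\bigcup_(c in [set` s]) eball (ctr c) 1) `&` eball 0 rho)) mb.
  have -> : (\sum_(i <- s) V (@vec4 R @^-1` eball (ctr i) 1) = ((size s)%:R * (pi ^+ 2 / 2))%:E)%E.
    rewrite (eq_bigr (fun=> (pi ^+ 2 / 2)%:E)) => [|c _].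
      by rewrite sumEFin big_const_seq count_predT iter_addr_0 mulr_natl.
    by have := @vol4_eball R (ctr c) 1 ler01; rewrite expr1n mulr1.
  apply.
    rewrite preimage_setI preimage_bigcup; apply: measurableI => //.
    apply: fin_bigcup_measurable => [|c _] //; exact: finite_seq.
  by move=> z [[c cs zc] _]; exists c.
rewrite /covered_proportion vol4_eball ?(ltW rho0) //.
have w0 : 0 < pi ^+ 2 / 2 * rho ^+ 4 by rewrite mulr_gt0 ?exprn_gt0 // divr_gt0 ?exprn_gt0.
rewrite inver (gt_eqF w0) lee_pdivrMr // -EFinM; apply: (le_trans covle).
rewrite lee_fin.
have E1 : (rho + 1 + 3) = rho + 4 by ring.
rewrite E1 in sle.
have -> : pi ^+ 2 / 16 * ((rho + 4) / rho) ^+ 4 * (pi ^+ 2 / 2 * rho ^+ 4) =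
  (pi ^+ 2 / 2 * (rho + 4) ^+ 4 / 8) * (pi ^+ 2 / 2).
  by move: (pi ^+ 2) => p; field; rewrite gt_eqF.
by rewrite ler_wpM2r ?divr_ge0 ?sqr_ge0 // ler_pdivlMr.
Qed.

Lemma density_bound : (density F <= (pi ^+ 2 / 16)%:E)%E.
Proof.
apply: (@limsup_le _ _ _ 4) => //; last exact: covered_bound.
have pi0 := pi_gt0 R; have := pihalf_lt2 R => p4.
rewrite divr_ge0 ?sqr_ge0 //= ler_pdivrMr // mul1r.
have : 0 <= (4 - pi) * (4 + pi : R) by rewrite mulr_ge0; lra.
lra.
Qed.

End Core.

Theorem theorem2p3 (R : realType) (Lam L : set 'rV[R]_4)
    (hLam : square_lattice 2 Lam \/ triangular_lattice 2 Lam)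
    (hL : L = unit_ball_union Lam)
    (F : set (set 'rV[R]_4))
    (hF : forall A, F A -> exists x : 'rV[R]_4, A = translate x L)
    (hpack : packing F) :
  (density F <= (pi ^+ 2 / 16)%:E)%E.
Proof.
subst L; have norm2 (v : 'rV[R]_4) : enorm v = 2 -> dot v v = 4.
  by move=> v2; rewrite -enorm_sqr v2; ring.
case: hLam => -[a [b [/norm2 aa /norm2 bb]]].
  move=> ab LE; subst Lam.
  apply: (@density_bound R a b 0 2 1 2 aa bb _ _ _ _ _ _ _ F hF hpack).
  - by rewrite ab mulr0.
  - by ring.
  - by rewrite ltr0n lexx.
  - by rewrite ltr01 lexx.
  - by [].
  - by ring.
  - by move=> T Y P Q; exact: square_sep.
move=> /norm2 abd LE; subst Lam.
have r30 : 0 < (Num.sqrt 3 : R) by rewrite sqrtr_gt0.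
have r3 : (Num.sqrt 3 : R) ^+ 2 = 3 by rewrite sqr_sqrtr.
have ab : dot a b = 2 * 1.
  by move: abd; rewrite dotDl !dotDr !dotNl !dotNr (dot_sym b a); lra.
apply: (@density_bound R a b 1 (Num.sqrt 3) (8 / 9) (4 / Num.sqrt 3) aa bb ab _ _ _ _ _ _ F
  hF hpack).
- by rewrite r3; ring.
- rewrite r30 /=; nra.
- by apply/andP; split; lra.
- by rewrite divr_ge0 // ltW.
- by field; rewrite gt_eqF.
- by move=> T Y P Q; exact: triangular_sep.
Qed.
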